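(* Let $\mathfrak g\geq 1$ and let $H$ be a torsion-free malnormal convex-cocompact subgroup of $MCG(\Sigma_{\mathfrak g})$. If the extension group $\Gamma_H$ is conjugacy separable, then $H$ is separable in $MCG(\Sigma_{\mathfrak g})$.
   Context: $\Sigma_{\mathfrak g}$ is the closed connected orientable surface of genus $\mathfrak g$, and $MCG(\Sigma_{\mathfrak g})$ is its (orientation-preserving) mapping class group, regarded as an index-2 subgroup of $\mathrm{Out}(\pi_1(\Sigma_{\mathfrak g}))$. For $H\leq MCG(\Sigma_{\mathfrak g})$, $\Gamma_H$ is the preimage of $H$ under the natural map $MCG(\Sigma_{\mathfrak g}-\{p\})\to MCG(\Sigma_{\mathfrak g})$ appearing in the Birman exact sequence, where $p\in\Sigma_{\mathfrak g}$ is a point (for $\mathfrak g\ge 2$, equivalently the preimage of $H$ under $\mathrm{Aut}(\pi_1(\Sigma_{\mathfrak g}))\to\mathrm{Out}(\pi_1(\Sigma_{\mathfrak g}))$). A finitely generated subgroup of $MCG(\Sigma_{\mathfrak g})$ is convex-cocompact if its orbit maps to the curve graph $\mathcal C(\Sigma_{\mathfrak g})$ are quasi-isometric embeddings (with the usual Farey graph convention for the curve graph in sporadic cases). A subgroup $H\le G$ is malnormal if $H\cap gHg^{-1}=\{1\}$ for all $g\in G-H$. A subgroup $H$ of $G$ is separable in $G$ if for all $g\in G-H$ there exist a finite group $F$ and a homomorphism $\phi:G\to F$ with $\phi(g)\notin\phi(H)$. A group is conjugacy separable if any two non-conjugate elements have non-conjugate images in some finite quotient. *)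

(* Defs.v *)
From HB Require Import structures.
From mathcomp Require Import all_boot all_order all_algebra all_fingroup.
From mathcomp Require Import generic_quotient.
From mathcomp Require Import all_classical all_reals all_analysis.

Set Implicit Arguments.
Unset Strict Implicit.
Unset Printing Implicit Defensive.

Import Order.TTheory GRing.Theory Num.Theory numFieldNormedType.Exports.

Local Open Scope quotient_scope.
Local Open Scope classical_set_scope.

Section Subgroups.
Local Open Scope group_scope.
Variable T : groupType.
Implicit Types G H : set T.

Definition is_subgroup G : Prop :=
  G 1 /\ forall x y, G x -> G y -> G (x * y^-1).

Definition torsion_free H : Prop :=
  forall x n, H x -> (0 < n)%N -> x ^+ n = 1 -> x = 1.

Definition malnormal G H : Prop :=
  forall x, G x -> ~ H x -> H `&` [set x * h * x^-1 | h in H] = [set 1].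

(* A homomorphism defined on the subgroup [G] is represented by a function on
   the whole of [T], whose values outside [G] are irrelevant. *)
Definition hom_on G (F : groupType) (f : T -> F) : Prop :=
  forall x y, G x -> G y -> f (x * y) = f x * f y.

Definition separable G H : Prop :=
  forall x, G x -> ~ H x ->
  exists (F : finGroupType) (f : T -> F), hom_on G f /\ ~ (f @` H) (f x).

Definition conjugate_in G x y : Prop := exists2 z, G z & y = x ^ z.

Definition conjugacy_separable G : Prop :=
  forall x y, G x -> G y -> ~ conjugate_in G x y ->
  exists (F : finGroupType) (f : T -> F),
    [/\ hom_on G f, f @` G = [set: F] & ~ exists z : F, f y = f x ^ z].

Definition generates (S : seq T) H : Prop :=
  H = smallest is_subgroup [set` S].

Definition cayley_adj (S : seq T) x y : Prop :=
  exists2 s, s \in S & y = x * s \/ y = x * s^-1.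

End Subgroups.

Section Metrics.
Local Open Scope ereal_scope.
Variable R : realType.

Fixpoint walk (V : Type) (adj : V -> V -> Prop) (n : nat) (u v : V) : Prop :=
  if n is m.+1 then exists2 w, adj u w & walk adj m w v else u = v.

(* [+oo] between distinct connected components. *)
Definition graph_dist (V : Type) (adj : V -> V -> Prop) (u v : V) : \bar R :=
  ereal_inf [set n%:R%:E | n in [set n | walk adj n u v]].

Definition qi_embedding (X Y : Type) (A : set X)
    (dX : X -> X -> \bar R) (dY : Y -> Y -> \bar R) (f : X -> Y) : Prop :=
  exists K C : R, [/\ (1 <= K)%R, (0 <= C)%R & forall x y, A x -> A y ->
    K^-1%:E * dX x y - C%:E <= dY (f x) (f y) /\
    dY (f x) (f y) <= K%:E * dX x y + C%:E].

End Metrics.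

(* [(x, false)] is the generator [x], and [(x, true)] its inverse. *)
Definition word (I : choiceType) : choiceType := seq (I * bool).

Definition winv (I : choiceType) (w : word I) : word I :=
  rev [seq (l.1, ~~ l.2) | l <- w].

Inductive word_equiv (I : choiceType) (rels : seq (word I)) :
    word I -> word I -> Prop :=
| word_equiv_refl u : word_equiv rels u u
| word_equiv_sym u v : word_equiv rels u v -> word_equiv rels v u
| word_equiv_trans v u w :
    word_equiv rels u v -> word_equiv rels v w -> word_equiv rels u w
| word_equiv_cancel u v x b :
    word_equiv rels (u ++ (x, b) :: (x, ~~ b) :: v) (u ++ v)
| word_equiv_relator u v r :
    r \in rels -> word_equiv rels (u ++ r ++ v) (u ++ v).

Section Presented.
Variables (I : choiceType) (rels : seq (word I)).
Local Notation weq := (word_equiv rels).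

Definition word_eqb : rel (word I) := fun u v => `[< weq u v >].

Lemma word_eqb_refl : reflexive word_eqb.
Proof. by move=> u; apply/asboolP; exact: word_equiv_refl. Qed.

Lemma word_eqb_sym : symmetric word_eqb.
Proof.
by move=> u v; apply/asboolP/asboolP => h; exact: word_equiv_sym.
Qed.

Lemma word_eqb_trans : transitive word_eqb.
Proof.
move=> v u w /asboolP uv /asboolP vw; apply/asboolP.
exact: word_equiv_trans uv vw.
Qed.

Canonical word_eqb_equiv :=
  EquivRel word_eqb word_eqb_refl word_eqb_sym word_eqb_trans.

Definition presented : Type := {eq_quot word_eqb}.

HB.instance Definition _ := Choice.on presented.
HB.instance Definition _ := Quotient.on presented.
HB.instance Definition _ := EqQuotient.on presented.

Lemma piE u v : \pi_presented u = \pi_presented v <-> weq u v.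
Proof.
split=> [/eqP|h]; first by rewrite eqmodE => /asboolP.
by apply/eqP; rewrite eqmodE; apply/asboolP.
Qed.

Lemma repr_pi w : weq (repr (\pi_presented w)) w.
Proof. by apply/piE; rewrite reprK. Qed.

Lemma word_equiv_cat u u' v v' :
  weq u u' -> weq v v' -> weq (u ++ v) (u' ++ v').
Proof.
have aux s t : weq s t -> forall p q, weq (p ++ s ++ q) (p ++ t ++ q).
  elim=> {s t} [u0 p q|u0 v0 _ IH p q|v0 u0 w0 _ IH1 _ IH2 p q|u0 v0 x b p q|
      u0 v0 r rr p q].
  - exact: word_equiv_refl.
  - exact: word_equiv_sym.
  - by apply: (word_equiv_trans (IH1 p q)).
  - by rewrite -!catA !cat_cons !(catA p u0); exact: word_equiv_cancel.
  - by rewrite -!catA !(catA p u0); exact: word_equiv_relator.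
move=> uu vv; apply: (word_equiv_trans (v := u' ++ v)).
  by have := aux _ _ uu [::] v.
by have := aux _ _ vv u' [::]; rewrite !cats0.
Qed.

Lemma word_equiv_winvl w : weq (winv w ++ w) [::].
Proof.
elim: w => [|[x b] w IH]; first exact: word_equiv_refl.
rewrite /winv /= rev_cons cat_rcons; apply: word_equiv_trans IH.
by rewrite -{2}(negbK b); exact: word_equiv_cancel.
Qed.

Lemma winvK : involutive (@winv I).
Proof.
move=> w; rewrite /winv map_rev revK -map_comp -[RHS]map_id.
by apply: eq_map => -[x b] /=; rewrite negbK.
Qed.

Lemma word_equiv_winvr w : weq (w ++ winv w) [::].
Proof. by rewrite -{1}(winvK w); exact: word_equiv_winvl. Qed.

Definition pres_one : presented := \pi_presented [::].
Definition pres_mul (x y : presented) : presented :=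
  \pi_presented (repr x ++ repr y).
Definition pres_inv (x : presented) : presented := \pi_presented (winv (repr x)).

Lemma pres_mulA : associative pres_mul.
Proof.
move=> x y z; apply/piE.
apply: (word_equiv_trans (v := repr x ++ repr y ++ repr z)).
  by apply: word_equiv_cat; [exact: word_equiv_refl|exact: repr_pi].
rewrite catA; apply: word_equiv_cat; last exact: word_equiv_refl.
by apply: word_equiv_sym; exact: repr_pi.
Qed.

Lemma pres_mul1 : left_id pres_one pres_mul.
Proof.
move=> x; rewrite -[RHS]reprK; apply/piE; rewrite -[X in weq _ X]cat0s.
by apply: word_equiv_cat; [exact: repr_pi|exact: word_equiv_refl].
Qed.

Lemma pres_mulr1 : right_id pres_one pres_mul.
Proof.
move=> x; rewrite -[RHS]reprK; apply/piE; rewrite -[X in weq _ X]cats0.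
by apply: word_equiv_cat; [exact: word_equiv_refl|exact: repr_pi].
Qed.

Lemma pres_mulV : left_inverse pres_one pres_inv pres_mul.
Proof.
move=> x; apply/piE; apply: word_equiv_trans (word_equiv_winvl (repr x)).
by apply: word_equiv_cat; [exact: repr_pi|exact: word_equiv_refl].
Qed.

Lemma pres_mulrV : right_inverse pres_one pres_inv pres_mul.
Proof.
move=> x; apply/piE; apply: word_equiv_trans (word_equiv_winvr (repr x)).
by apply: word_equiv_cat; [exact: word_equiv_refl|exact: repr_pi].
Qed.

HB.instance Definition _ := isGroup.Build presented
  pres_mulA pres_mul1 pres_mulr1 pres_mulV pres_mulrV.

End Presented.

Section Aut.
Local Open Scope group_scope.
Variable G : groupType.

Definition is_automorphism (f : G -> G) : bool :=
  `[< {morph f : x y / x * y} /\ bijective f >].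

Definition gaut : Type := {f : G -> G | is_automorphism f}.

HB.instance Definition _ := SubChoice.on gaut.

Definition gaut_fun (f : gaut) : G -> G := val f.
Coercion gaut_fun : gaut >-> Funclass.

Lemma gautP (f : gaut) : {morph f : x y / x * y} /\ bijective f.
Proof. by apply/asboolP; exact: (valP f). Qed.

Lemma gaut_eqP (f g : gaut) : f =1 g -> f = g.
Proof. by move=> fg; apply: val_inj; apply/funext. Qed.

Lemma id_automorphism : is_automorphism id.
Proof. by apply/asboolP; split=> //; exists id. Qed.

Lemma comp_automorphism (f g : gaut) : is_automorphism (f \o g).
Proof.
case: (gautP f) (gautP g) => [fM fB] [gM gB]; apply/asboolP; split.
  by move=> x y /=; rewrite gM fM.
exact: bij_comp.
Qed.

Lemma gaut_inv_subproof (f : gaut) :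
  exists2 h : gaut, cancel f h & cancel h f.
Proof.
case: (gautP f) => fM [h fK hK].
have hP : is_automorphism h.
  apply/asboolP; split; last by exists f.
  by move=> x y; apply: (can_inj fK); rewrite fM !hK.
by exists (exist _ h hP).
Qed.

Definition gaut_one : gaut := exist _ id id_automorphism.
Definition gaut_mul (f g : gaut) : gaut := exist _ (f \o g) (comp_automorphism f g).
Definition gaut_inv (f : gaut) : gaut := s2val (cid2 (gaut_inv_subproof f)).

Lemma gaut_mulA : associative gaut_mul.
Proof. by move=> f g h; exact: gaut_eqP. Qed.
Lemma gaut_mul1 : left_id gaut_one gaut_mul.
Proof. by move=> f; exact: gaut_eqP. Qed.
Lemma gaut_mulr1 : right_id gaut_one gaut_mul.
Proof. by move=> f; exact: gaut_eqP. Qed.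
Lemma gaut_mulV : left_inverse gaut_one gaut_inv gaut_mul.
Proof.
by move=> f; apply: gaut_eqP; exact: (s2valP (cid2 (gaut_inv_subproof f))).
Qed.
Lemma gaut_mulrV : right_inverse gaut_one gaut_inv gaut_mul.
Proof.
by move=> f; apply: gaut_eqP; exact: (s2valP' (cid2 (gaut_inv_subproof f))).
Qed.

HB.instance Definition _ := isGroup.Build gaut
  gaut_mulA gaut_mul1 gaut_mulr1 gaut_mulV gaut_mulrV.

Definition inner_equiv (f g : gaut) : Prop := exists z, forall x, g x = f x ^ z.

Definition inner_eqb : rel gaut := fun f g => `[< inner_equiv f g >].

Lemma inner_eqb_refl : reflexive inner_eqb.
Proof. by move=> f; apply/asboolP; exists 1 => x; rewrite conjg1. Qed.

Lemma inner_eqb_sym : symmetric inner_eqb.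
Proof.
move=> f g; apply/asboolP/asboolP => -[z fg]; exists z^-1 => x;
  by rewrite fg conjgK.
Qed.

Lemma inner_eqb_trans : transitive inner_eqb.
Proof.
move=> g f h /asboolP[z fg] /asboolP[t gh]; apply/asboolP.
by exists (z * t) => x; rewrite gh fg conjgM.
Qed.

Canonical inner_eqb_equiv :=
  EquivRel inner_eqb inner_eqb_refl inner_eqb_sym inner_eqb_trans.

Definition gout : Type := {eq_quot inner_eqb}.

HB.instance Definition _ := Choice.on gout.
HB.instance Definition _ := Quotient.on gout.
HB.instance Definition _ := EqQuotient.on gout.

Lemma gout_piE (f g : gaut) : \pi_gout f = \pi_gout g <-> inner_equiv f g.
Proof.
split=> [/eqP|h]; first by rewrite eqmodE => /asboolP.
by apply/eqP; rewrite eqmodE; apply/asboolP.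
Qed.

Lemma gout_repr_pi (f : gaut) : inner_equiv (repr (\pi_gout f)) f.
Proof. by apply/gout_piE; rewrite reprK. Qed.

Lemma inner_equiv_mul (f f' g g' : gaut) :
  inner_equiv f f' -> inner_equiv g g' -> inner_equiv (f * g) (f' * g').
Proof.
move=> [z ff] [t gg]; exists (f t * z) => x.
have [fM _] := gautP f; have fV y : f y^-1 = (f y)^-1.
  have f1 : f 1 = 1 by apply: (mulgI (f 1)); rewrite -fM !mulg1.
  by apply: (mulgI (f y)); rewrite -fM !mulgV.
have fJ y u : f (y ^ u) = f y ^ f u by rewrite /conjg !fM fV.
by rewrite [LHS]ff gg fJ conjgM.
Qed.

Definition gout_one : gout := \pi_gout 1.
Definition gout_mul (x y : gout) : gout := \pi_gout (repr x * repr y).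
Definition gout_inv (x : gout) : gout := \pi_gout (repr x)^-1.

Lemma pi_goutM (f g : gaut) :
  gout_mul (\pi_gout f) (\pi_gout g) = \pi_gout (f * g).
Proof. by apply/gout_piE/inner_equiv_mul; exact: gout_repr_pi. Qed.

Lemma gout_mulA : associative gout_mul.
Proof.
move=> x y z; rewrite -(reprK x) -(reprK y) -(reprK z).
move: (repr x) (repr y) (repr z) => f h k.
by rewrite (pi_goutM h k) (pi_goutM f h) (pi_goutM f) (pi_goutM _ k) mulgA.
Qed.
Lemma gout_mul1 : left_id gout_one gout_mul.
Proof. by move=> x; rewrite -(reprK x) (pi_goutM 1) mul1g. Qed.
Lemma gout_mulr1 : right_id gout_one gout_mul.
Proof. by move=> x; rewrite -(reprK x) (pi_goutM _ 1) mulg1. Qed.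
Lemma gout_mulV : left_inverse gout_one gout_inv gout_mul.
Proof.
move=> x; rewrite -[X in gout_mul _ X](reprK x).
by rewrite (pi_goutM _ (repr x)) mulVg.
Qed.
Lemma gout_mulrV : right_inverse gout_one gout_inv gout_mul.
Proof.
move=> x; rewrite -[X in gout_mul X _](reprK x).
by rewrite (pi_goutM (repr x)) mulgV.
Qed.

HB.instance Definition _ := isGroup.Build gout
  gout_mulA gout_mul1 gout_mulr1 gout_mulV gout_mulrV.

End Aut.

Section SurfaceGroups.
Local Open Scope group_scope.
Variable g : nat.

(* [inl i] is the standard generator a_i, and [inr i] is b_i. *)
Definition sgen : choiceType := ('I_g + 'I_g)%type.

Definition surface_relator : word sgen :=
  flatten [seq [:: (inl i, false); (inr i, false); (inl i, true); (inr i, true)]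
          | i <- enum 'I_g].

(* The fundamental group of the closed surface of genus [g]. *)
Definition surface_group : groupType := presented [:: surface_relator].

(* The fundamental group of the once-punctured surface of genus [g]: it is free,
   and [surface_relator] is a loop around the puncture. *)
Definition punctured_surface_group : groupType := presented (Nil (word sgen)).

Definition puncture_loop : punctured_surface_group :=
  \pi_(presented (Nil (word sgen))) surface_relator.

(* Induced by the inclusion of the punctured surface in the closed surface. *)
Definition fill_puncture (x : punctured_surface_group) : surface_group :=
  \pi_(presented [:: surface_relator]) (repr x).

Definition exponent_sum (x : sgen) (w : word sgen) : int :=
  ((count_mem (x, false) w)%:Z - (count_mem (x, true) w)%:Z)%R.

(* The algebraic intersection form of the surface, pulled back from H_1; the
   exponent sums do not depend on the representing words, because they vanish
   on [surface_relator]. *)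
Definition intersection_form (x y : surface_group) : int :=
  (\sum_(i < g) (exponent_sum (inl i) (repr x) * exponent_sum (inr i) (repr y)
               - exponent_sum (inr i) (repr x) * exponent_sum (inl i) (repr y)))%R.

(* The other automorphisms change the sign of the intersection form. *)
Definition orientation_preserving (f : gaut surface_group) : Prop :=
  forall x y, intersection_form (f x) (f y) = intersection_form x y.

(* Inner automorphisms act trivially on H_1, so the choice of a representative
   does not matter. *)
Definition mapping_class_group : set (gout surface_group) :=
  [set c | orientation_preserving (repr c)].

End SurfaceGroups.

Arguments mapping_class_group g : clear implicits.

(* A group containing the mapping class group of the once-punctured surface of
   genus [g]. For [g >= 2], that mapping class group consists of the orientation
   preserving automorphisms of [surface_group g], the point pushes being the
   inner automorphisms. In genus 1 the point pushes are isotopic to the identity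
   and this description fails; there, the mapping class group consists of the
   outer automorphisms of the free group [punctured_surface_group 1] that
   preserve the conjugacy class of the oriented loop around the puncture. *)
Definition punctured_mcg_ambient (g : nat) : groupType :=
  match g with
  | 1 => gout (punctured_surface_group 1)
  | _ => gaut (surface_group g)
  end.

(* The preimage of [H] under the map that fills in the puncture, for [H] contained
   in [mapping_class_group g]. In genus 1, this map sends the class of [f] to the
   class of the automorphism [h] that [f] induces on [surface_group 1]. *)
Definition extension_group (g : nat) :
    set (gout (surface_group g)) -> set (punctured_mcg_ambient g) :=
  match g with
  | 1 => fun H => [set c | exists (f : gaut (punctured_surface_group 1))
                                  (h : gaut (surface_group 1)),
      [/\ c = \pi_(gout (punctured_surface_group 1)) f,
          exists z, f (puncture_loop 1) = (puncture_loop 1 ^ z)%g,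
          forall x, fill_puncture (f x) = h (fill_puncture x)
        & H (\pi_(gout (surface_group 1)) h)]]
  | _ => fun H => [set f | H (\pi_(gout (surface_group _)) f)]
  end.

Section Surface.
Local Open Scope ring_scope.
Variables (R : realType) (g : nat).

Definition disk : set (R * R) := [set z | z.1 ^+ 2 + z.2 ^+ 2 <= 1].

Definition circle_pt (t : R) : R * R := (cos t, sin t).

Lemma circle_pt_disk (t : R) : circle_pt t \in disk.
Proof. by rewrite inE /disk /= cos2Dsin2. Qed.

(* The unit disk is viewed as a polygon with [4 * g] sides, the [k]-th of which
   is parametrised by [0 <= s <= 1]. *)
Definition side (k : nat) (s : R) : disk :=
  exist (fun z => z \in disk) _ (circle_pt_disk (2 * pi * (k%:R + s) / (4 * g)%:R)).

(* Read counterclockwise, the boundary of the polygon is [surface_relator g]. *)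
Inductive glued : disk -> disk -> Prop :=
| glued_a (i : 'I_g) (s : R) : 0 <= s <= 1 ->
    glued (side (4 * i) s) (side (4 * i + 2) (1 - s))
| glued_b (i : 'I_g) (s : R) : 0 <= s <= 1 ->
    glued (side (4 * i + 1) s) (side (4 * i + 3) (1 - s))
| glued_refl z : glued z z
| glued_sym y z : glued y z -> glued z y
| glued_trans y x z : glued x y -> glued y z -> glued x z.

Definition gluedb : rel disk := fun y z => `[< glued y z >].

Lemma gluedb_refl : reflexive gluedb.
Proof. by move=> z; apply/asboolP; exact: glued_refl. Qed.

Lemma gluedb_sym : symmetric gluedb.
Proof. by move=> y z; apply/asboolP/asboolP => h; exact: glued_sym. Qed.

Lemma gluedb_trans : transitive gluedb.
Proof.
move=> y x z /asboolP xy /asboolP yz; apply/asboolP.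
exact: glued_trans xy yz.
Qed.

Canonical gluedb_equiv := EquivRel gluedb gluedb_refl gluedb_sym gluedb_trans.

Definition surface : topologicalType := quotient_topology {eq_quot gluedb}.

Definition to_surface (z : disk) : surface := \pi_({eq_quot gluedb}) z.

(* Closed curves are 1-periodic maps on the real line. *)
Definition closed_curve (c : R -> surface) : Prop :=
  continuous c /\ forall t, c (t + 1) = c t.

Definition simple_curve (c : R -> surface) : Prop :=
  forall s t, 0 <= s < 1 -> 0 <= t < 1 -> c s = c t -> s = t.

Definition freely_homotopic (c d : R -> surface) : Prop :=
  exists h : R * R -> surface,
    [/\ continuous h, forall s t, h (s, t + 1) = h (s, t),
        forall t, h (0, t) = c t & forall t, h (1, t) = d t].

Definition letter_path (l : sgen g * bool) (s : R) : surface :=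
  let k := match l.1 with inl i => 4 * i | inr i => 4 * i + 1 end%N in
  to_surface (side k (if l.2 then 1 - s else s)).

(* The closed edge path spelled by [w], based at the common image of the vertices
   of the polygon. *)
Definition word_curve (w : word (sgen g)) (t : R) : surface :=
  let u := (size w)%:R * (t - (Num.floor t)%:~R) in
  let k := Num.truncn u in
  if onth w k is Some l then letter_path l (u - k%:R)
  else to_surface (side 0 0).

Definition represents (c : R -> surface) (x : surface_group g) : Prop :=
  exists2 w, x = \pi_(presented [:: surface_relator g]) w &
    freely_homotopic c (word_curve w).

End Surface.

Section CurveGraph.
Variables (R : realType) (g : nat).

(* Unoriented free homotopy classes of closed curves correspond to conjugacy
   classes of the fundamental group, up to inversion. *)
Definition unoriented_class (x : surface_group g) : set (surface_group g) :=
  [set y | exists z, y = (x ^ z)%g \/ y = (x^-1 ^ z)%g].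

(* [c] is an essential simple closed curve with unoriented homotopy class [v].
   Essential simple closed curves are isotopic if and only if they are homotopic,
   so that [v] stands for the isotopy class of [c]. *)
Definition essential_scc (c : R -> surface R g) (v : set (surface_group g)) :
    Prop :=
  [/\ closed_curve c, simple_curve c &
      exists x, [/\ x <> 1%g, represents c x & v = unoriented_class x]].

Definition curve_vertex (v : set (surface_group g)) : Prop :=
  exists c, essential_scc c v.

Definition meet_at_most (n : nat) (v w : set (surface_group g)) : Prop :=
  exists c d, [/\ essential_scc c v, essential_scc d w &
                  (range c `&` range d #<= `I_n)%card].

Definition geometric_intersection (v w : set (surface_group g)) (n : nat) :
    Prop :=
  meet_at_most n v w /\ forall m, (m < n)%N -> ~ meet_at_most m v w.

(* With the usual convention in genus 1, where this is the Farey graph. *)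
Definition curve_adj (v w : set (surface_group g)) : Prop :=
  v <> w /\ geometric_intersection v w (if g == 1%N then 1%N else 0%N).

Definition curve_action (c : gout (surface_group g))
  (v : set (surface_group g)) : set (surface_group g) := repr c @` v.

Definition convex_cocompact (H : set (gout (surface_group g))) : Prop :=
  (exists S, generates S H) /\
  forall S v, generates S H -> curve_vertex v ->
    qi_embedding H (graph_dist R (cayley_adj S)) (graph_dist R curve_adj)
      (curve_action ^~ v).

End CurveGraph.

(* Main.v *)
From HB Require Import structures.
Require Import Defs.
From mathcomp Require Import all_boot all_order all_algebra all_fingroup.
From mathcomp Require Import generic_quotient.
From mathcomp Require Import all_classical all_reals all_analysis.
From mathcomp Require Import zify.

(* For g >= 2 the fundamental group contains an element Z such that every
   automorphism f with f Z conjugate to Z is inner.  Given phi outside H,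
   represented by f, the point pushes along Z and along f Z lie in the extension
   group, and they are not conjugate there: a conjugating element z would satisfy
   z (f Z) = Z, the fundamental group being centerless, so that z f would be inner
   and phi would lie in H.  A finite quotient F in which they stay non-conjugate
   yields a homomorphism from the fundamental group to F, and the action of outer
   automorphisms on conjugacy classes of homomorphisms to F separates phi from H.

   To find Z, let t = a_1 and consider the infinite cyclic cover dual to t, whose
   fundamental group is free on t^k s t^-k for the generators s of index >= 2, and
   b_1.  If y1, y2 in a free group have independent images in homology, then for
   suitable large coprime n1, n2 the equation x1^n1 x2^n2 = y1^n1 y2^n2 forces
   (x1, x2) = (y1, y2) up to conjugation by powers of the right-hand side: the
   axes of x1, x2 overlap those of y1, y2 in long segments.  Hence an automorphism
   fixing y1^n1 y2^n2 fixes y1 and y2 up to conjugation.  Iterating this, Z encodes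
   a finite list of elements t^k [t, s] t^-k and conjugates of these, enough to
   determine an automorphism.

   For g = 1 the hyperelliptic involution is central and, being of order 2, not in
   H; so malnormality makes H trivial, and reduction of homology modulo n separates
   any other class from 1. *)


Set Implicit Arguments.
Unset Strict Implicit.
Unset Printing Implicit Defensive.

Local Open Scope quotient_scope.
Local Open Scope group_scope.

(** * Presented groups *)

Section PresentedGroups.
Variables (I : choiceType) (rels : seq (word I)).

Definition pw (w : word I) : presented rels := \pi_(presented rels) w.

Lemma pw_eq u v : pw u = pw v <-> word_equiv rels u v.
Proof. exact: Defs.piE. Qed.

Lemma pw_repr (x : presented rels) : pw (repr x) = x.
Proof. exact: reprK. Qed.

Lemma pw_cat u v : pw (u ++ v) = pw u * pw v.
Proof.
apply/esym/pw_eq; apply: word_equiv_cat; exact: repr_pi.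
Qed.

Lemma pw_relator r : r \in rels -> pw r = 1.
Proof.
move=> rr; apply/pw_eq.
by have := @word_equiv_relator _ rels [::] [::] r rr; rewrite cats0.
Qed.

Lemma pw_nil : pw [::] = 1.
Proof. by []. Qed.

Lemma pw_cons l w : pw (l :: w) = pw [:: l] * pw w.
Proof. by rewrite -pw_cat. Qed.

Lemma pw_inv w : pw (winv w) = (pw w)^-1.
Proof.
apply/eqP; rewrite -mulg_eq1 -pw_cat; apply/eqP/pw_eq.
exact: word_equiv_winvl.
Qed.

Variable G : groupType.

Definition letter_val (phi : I -> G) (l : I * bool) : G :=
  if l.2 then (phi l.1)^-1 else phi l.1.

Fixpoint eval (phi : I -> G) (w : word I) : G :=
  if w is l :: w' then letter_val phi l * eval phi w' else 1.

Lemma eval_cat phi u v : eval phi (u ++ v) = eval phi u * eval phi v.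
Proof. by elim: u => [|l u IH] /=; rewrite ?mul1g // IH mulgA. Qed.

Lemma eval_equiv phi u v : (forall r, r \in rels -> eval phi r = 1) ->
  word_equiv rels u v -> eval phi u = eval phi v.
Proof.
move=> hr; elim=> {u v} [//|u v _ -> //|v u w _ -> _ -> //|u v x b|u v r rr].
  rewrite !eval_cat /=; congr (_ * _); rewrite /letter_val /=.
  by case: b; rewrite /= ?mulKg ?mulVKg.
by rewrite !eval_cat (hr r) // mul1g.
Qed.

Lemma morph_eval (f : presented rels -> G) w : {morph f : x y / x * y} ->
  f (pw w) = eval (fun i => f (pw [:: (i, false)])) w.
Proof.
move=> fM; have f1 : f 1 = 1 by apply: (mulgI (f 1)); rewrite -fM !mulg1.
have fV y : f y^-1 = (f y)^-1.
  by apply: (mulgI (f y)); rewrite -fM !mulgV.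
elim: w => [|[i b] w IH] /=; first exact: f1.
rewrite pw_cons fM IH; congr (_ * _); case: b => //.
by rewrite /letter_val /= -fV -pw_inv.
Qed.

End PresentedGroups.

(** * Elementary identities for group homomorphisms *)

Section MorphismFacts.
Variables (G K : groupType) (f : G -> K).
Hypothesis fM : {morph f : x y / x * y}.

Lemma morph1_of : f 1 = 1.
Proof. by apply: (mulgI (f 1)); rewrite -fM !mulg1. Qed.

Lemma morphV_of x : f x^-1 = (f x)^-1.
Proof. by apply: (mulgI (f x)); rewrite -fM !mulgV morph1_of. Qed.

Lemma morphX_of x n : f (x ^+ n) = f x ^+ n.
Proof. by elim: n => [|n IH]; rewrite ?expg0 ?morph1_of // !expgS fM IH. Qed.

Lemma morphJ_of x y : f (x ^ y) = f x ^ f y.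
Proof. by rewrite /conjg !fM morphV_of. Qed.

End MorphismFacts.

(** * Reduced words in free groups *)

Section ReducedWords.
Variable I : choiceType.
Implicit Types (l m : (I * bool)%type) (u v w c : seq (I * bool)).

Definition linv l : (I * bool)%type := (l.1, ~~ l.2).

Lemma linvK : involutive linv.
Proof. by case=> i b; rewrite /linv /= negbK. Qed.

Lemma linv_neq l : linv l != l.
Proof. by case: l => i []; rewrite /linv /= xpair_eqE andbF. Qed.

Definition reduced w := sorted (fun l m => m != linv l) w.

(** True when either word is empty, so that [reduced_cat] needs no side condition. *)
Definition junction u v :=
  if u is x :: u' then if v is y :: _ then y != linv (last x u') else true
  else true.

Lemma reduced_cat u v :
  reduced (u ++ v) = [&& reduced u, reduced v & junction u v].
Proof.
case: u => [|x u]; first by rewrite /= andbC.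
case: v => [|y v]; first by rewrite cats0 /= !andbT.
by rewrite /reduced /= cat_path /=; case: path => //=; rewrite andbC.
Qed.

Lemma junctionP x u y v : junction (rcons u x) (y :: v) = (y != linv x).
Proof. by case: u => //= z u; rewrite last_rcons. Qed.

Lemma reduced_cat3 u v w : v != [::] ->
  reduced (u ++ v) -> reduced (v ++ w) -> reduced (u ++ v ++ w).
Proof.
rewrite !reduced_cat; case: v => // y v _ /and3P[-> _ uv] /and3P[-> -> ->] /=.
by case: u uv.
Qed.

Lemma winv_cons l w : winv (l :: w) = rcons (winv w) (linv l).
Proof. by rewrite /winv /= rev_cons. Qed.

Lemma winv_rcons w l : winv (rcons w l) = linv l :: winv w.
Proof. by rewrite /winv map_rcons rev_rcons. Qed.

Lemma winv_cat u v : winv (u ++ v) = winv v ++ winv u.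
Proof. by rewrite /winv map_cat rev_cat. Qed.

Lemma size_winv w : size (winv w) = size w.
Proof. by rewrite /winv size_rev size_map. Qed.

Lemma reduced_winv w : reduced (winv w) = reduced w.
Proof.
elim: w => [//|x [//|y w] IH].
rewrite winv_cons -cats1 reduced_cat IH andTb winv_cons junctionP andbC.
congr (_ && _); rewrite linvK; case: x => i b; case: y {IH} => j c.
by rewrite /linv !xpair_eqE /= eq_sym; case: b; case: c.
Qed.

Definition rstep l w :=
  if w is m :: w' then if m == linv l then w' else l :: w else [:: l].

Definition reduce w := foldr rstep [::] w.

Lemma rstep_reduced l w : reduced w -> reduced (rstep l w).
Proof.
case: w => [//|m w] /=; case: eqP => [_|/eqP ml]; first by case: w => //= y w /andP[].
by rewrite /reduced /= ml.
Qed.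

Lemma reduce_reduced w : reduced (reduce w).
Proof. by elim: w => //= l w; exact: rstep_reduced. Qed.

(** Letters act on reduced words by mutually inverse maps. By van der Waerden's argument, [reduce]
    is then constant on classes of equivalent words, so reduced representatives are unique. *)
Lemma rstepK l w : reduced w -> rstep l (rstep (linv l) w) = w.
Proof.
case: w => [_|m w] /=; first by rewrite eqxx.
rewrite linvK; case: eqP => [->|ml]; last by rewrite /= eqxx.
by case: w => [//|y w] /= /andP[/negPf-> _].
Qed.

Lemma reduce_id w : reduced w -> reduce w = w.
Proof.
elim: w => //= l w IH rw; rewrite IH; first by case: w rw {IH} => //= m w /andP[/negPf-> _].
by case: w rw {IH} => //= m w /andP[].
Qed.

Lemma reduce_equiv u v : word_equiv (Nil (word I)) u v -> reduce u = reduce v.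
Proof.
elim=> {u v} [//|u v _ -> //|v u w _ -> _ -> //|u v x b|//].
rewrite /reduce !foldr_cat /=; congr (foldr _ _ _).
have /= := @rstepK (x, b) (reduce v) (reduce_reduced v).
by [].
Qed.

Definition fg : groupType := presented (Nil (word I)).

Definition fw w : fg := pw (Nil (word I)) w.

Lemma fw_cat u v : fw (u ++ v) = fw u * fw v.
Proof. exact: pw_cat. Qed.

Lemma rstep_fw l w : fw (rstep l w) = fw (l :: w).
Proof.
case: w => [//|m w] /=; case: eqP => [->|//].
by apply/esym/pw_eq; case: l => i b; exact: (word_equiv_cancel _ [::]).
Qed.

Lemma reduce_fw w : fw (reduce w) = fw w.
Proof.
by elim: w => //= l w IH; rewrite rstep_fw -cat1s fw_cat IH -fw_cat.
Qed.

Lemma fw_inj u v : reduced u -> reduced v -> fw u = fw v -> u = v.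
Proof. by move=> ru rv /pw_eq/reduce_equiv; rewrite !reduce_id. Qed.

Definition nf (x : fg) : seq (I * bool) := reduce (repr x).

Lemma nf_reduced x : reduced (nf x).
Proof. exact: reduce_reduced. Qed.

Lemma nfK x : fw (nf x) = x.
Proof. by rewrite reduce_fw /fw pw_repr. Qed.

Lemma fwK w : reduced w -> nf (fw w) = w.
Proof. by move=> rw; apply: fw_inj => //; [exact: nf_reduced|exact: nfK]. Qed.

Lemma fw_nil : fw [::] = 1.
Proof. by []. Qed.

Lemma fw_inv w : fw (winv w) = (fw w)^-1.
Proof. exact: pw_inv. Qed.

Lemma fw_eq1 w : reduced w -> fw w = 1 -> w = [::].
Proof. by move=> rw w1; apply: fw_inj. Qed.

(** The cancelled part [r] is found by peeling letters off the end of [u]. *)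
Lemma cancellation u v : reduced u -> reduced v ->
  exists p r s : seq (I * bool), [/\ u = p ++ r, v = winv r ++ s & reduced (p ++ s)].
Proof.
elim/last_ind: u v => [|u x IH] v; first by exists [::], [::], v.
move=> rux rv; have ru : reduced u by move: rux; rewrite -cats1 reduced_cat => /and3P[].
case: v rv => [_|y v ryv]; first by exists (rcons u x), [::], [::]; rewrite !cats0.
have [yx|yx] := eqVneq y (linv x); last first.
  exists (rcons u x), [::], (y :: v); split; rewrite ?cats0 //.
  by rewrite reduced_cat rux ryv junctionP.
have rv : reduced v by move: ryv; rewrite -cat1s reduced_cat => /and3P[].
have [p [r [s [-> -> rps]]]] := IH v ru rv.
exists p, (rcons r x), s; split; rewrite ?rcons_cat //.
by rewrite winv_rcons yx.
Qed.

End ReducedWords.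

(** * Periodic words *)

Section PeriodicWords.
Variable I : choiceType.
Implicit Types (u v w c d : seq (I * bool)) (i j k m n : nat).

Definition wpow c n := flatten (nseq n c).

(** Initial segment of the infinite periodic word c c c ...; for nonempty [c], [i] copies are long
    enough. *)
Definition pref c i := take i (wpow c i).

Definition cycred c := (c != [::]) && reduced (c ++ c).

Lemma cycred_size c : cycred c -> 0 < size c.
Proof. by case: c. Qed.

Lemma wpowD c m n : wpow c (m + n) = wpow c m ++ wpow c n.
Proof. by rewrite /wpow nseqD flatten_cat. Qed.

Lemma wpowS c n : wpow c n.+1 = c ++ wpow c n.
Proof. by []. Qed.

Lemma wpow1 c : wpow c 1 = c.
Proof. exact: cats0. Qed.

Lemma wpowSr c n : wpow c n.+1 = wpow c n ++ c.
Proof. by rewrite -addn1 wpowD wpow1. Qed.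

Lemma size_wpow c n : size (wpow c n) = (n * size c)%N.
Proof. by elim: n => // n IH; rewrite wpowS size_cat IH mulSn. Qed.

Lemma fw_wpow c n : fw (wpow c n) = fw c ^+ n.
Proof. by elim: n => // n IH; rewrite wpowS fw_cat IH expgS. Qed.

Lemma winv_wpow c n : winv (wpow c n) = wpow (winv c) n.
Proof. by elim: n => // n IH; rewrite wpowS winv_cat IH -wpowSr. Qed.

Lemma take_wpow c n i : 0 < size c -> i <= n * size c ->
  take i (wpow c n) = pref c i.
Proof.
move=> c0 hi; rewrite /pref; have hii : i <= i * size c by rewrite leq_pmulr.
case: (leqP n i) => h.
  rewrite -(subnKC h) wpowD takel_cat ?size_wpow //.
  by rewrite subnKC.
by rewrite -(subnKC (ltnW h)) wpowD takel_cat ?size_wpow.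
Qed.

Lemma take_pref c i j : 0 < size c -> i <= j -> take i (pref c j) = pref c i.
Proof.
move=> c0 ij; rewrite /pref take_takel // take_wpow //.
by apply: leq_trans ij _; rewrite leq_pmulr.
Qed.

Lemma pref_wpow c n : 0 < size c -> pref c (n * size c) = wpow c n.
Proof. by move=> c0; rewrite -(@take_wpow c n) // -size_wpow take_size. Qed.

Lemma pref_wpowD c n i : 0 < size c ->
  pref c (n * size c + i) = wpow c n ++ pref c i.
Proof.
move=> c0; have ii : i <= i * size c by rewrite leq_pmulr.
rewrite -(@take_wpow c (n + i)) // ?mulnDl ?leq_add2l //.
rewrite wpowD take_cat size_wpow ltnNge leq_addr /= addKn.
by rewrite take_wpow.
Qed.

Lemma fw_prefD c n i : 0 < size c ->
  fw (pref c (n * size c + i)) = fw c ^+ n * fw (pref c i).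
Proof. by move=> c0; rewrite pref_wpowD // fw_cat fw_wpow. Qed.

Lemma fw_prefS c i : 0 < size c ->
  fw (pref c (i + size c)) = fw c * fw (pref c i).
Proof. by move=> c0; rewrite addnC -{1}[size c]mul1n fw_prefD ?expg1. Qed.

Lemma reduced_wpow c n : cycred c -> reduced (wpow c n).
Proof.
case/andP=> c0 rcc; elim: n => // -[|n] IH.
  by rewrite wpow1; move: rcc; rewrite reduced_cat => /and3P[].
by rewrite wpowS wpowS; apply: reduced_cat3.
Qed.

Lemma cycred_reduced c : cycred c -> reduced c.
Proof. by move=> cc; have := reduced_wpow 1 cc; rewrite wpow1. Qed.

Lemma cycred_winv c : cycred (winv c) = cycred c.
Proof.
rewrite /cycred -winv_cat reduced_winv -!size_eq0 size_winv.
by [].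
Qed.

Lemma expgM_comm (G : groupType) (x y z : G) n :
  z * x = y * z -> z * x ^+ n = y ^+ n * z.
Proof.
by move=> zx; elim: n => [|n IH]; rewrite ?mulg1 ?mul1g // expgSr mulgA IH -mulgA zx mulgA -expgSr.
Qed.

(* The axes of [c] and of its conjugate [d] agree up to a translation. *)
Lemma conj_cycred c d (x : fg I) : cycred c -> cycred d ->
    x * fw d = fw c * x ->
  size c = size d /\
  exists m k, forall i, fw c ^+ m * x * fw (pref d i) = fw (pref c (k + i)).
Proof.
move=> cc cd xdc; have [u ru xu] : exists2 u, reduced u & x = fw u.
  by exists (nf x); [exact: nf_reduced|rewrite nfK].
have c0 := cycred_size cc; have d0 := cycred_size cd.
have xdM M : x * fw d ^+ M = fw c ^+ M * x by exact: expgM_comm.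
have cancM M : exists p' r' s' : seq (I * bool), [/\ wpow c M = p' ++ r', u = winv r' ++ s',
    reduced (p' ++ s') & fw (p' ++ s') = fw c ^+ M * x].
  have [p' [r' [s' [e1 e2 r]]]] := cancellation (reduced_wpow M cc) ru.
  exists p', r', s'; split=> //.
  rewrite -fw_wpow e1 xu e2 !fw_cat fw_inv -mulgA.
  by rewrite mulVKg.
have [m hm] : exists m, m = (2 * size u + 1)%N by eexists.
have [p [r [s [eu ed rps]]]] := cancellation ru (reduced_wpow m cd).
have s0 : s != [::].
  apply/negP => /eqP s0; move/(congr1 size): eu; move/(congr1 size): ed.
  have := leq_pmulr m d0.
  rewrite s0 !size_cat size_winv size_wpow /=. lia.
have fps M : fw (p ++ s ++ wpow d M) = x * fw d ^+ (m + M).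
  rewrite expgnDr -!fw_wpow ed xu eu !fw_cat fw_inv -!mulgA.
  by rewrite mulVKg.
have rpsM M : reduced (p ++ s ++ wpow d M).
  apply: reduced_cat3 => //.
  have := reduced_wpow (m + M) cd; rewrite wpowD ed -catA reduced_cat.
  by case/and3P.
have eqM M : exists p' r' s' : seq (I * bool), [/\ wpow c (m + M) = p' ++ r', u = winv r' ++ s'
    & p ++ s ++ wpow d M = p' ++ s'].
  have [p' [r' [s' [e1 e2 e3 e4]]]] := cancM (m + M)%N; exists p', r', s'.
  by split=> //; apply: fw_inj => //; rewrite fps e4 xdM.
split.
  have [p' [r' [s' [e1 e2 e3]]]] := eqM 0%N.
  move/(congr1 size): e1; move/(congr1 size): e2; move/(congr1 size): e3.
  move/(congr1 size): eu; move/(congr1 size): ed.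
  rewrite !size_cat !size_winv !size_wpow; nia.
exists m, (size p + size s)%N => i.
(* [M] is large enough for the first [size p + size s + i] letters to lie in [p'], where they spell
   a prefix of a power of [c]. *)
have [M hM] : exists M, M = (i + size p + size s + size u)%N by eexists.
have [p' [r' [s' [e1 e2 e3]]]] := eqM M.
have hi : size p + size s + i <= size p'.
  have := leq_pmulr (m + M) c0; move/(congr1 size): e1; move/(congr1 size): e2.
  rewrite !size_cat !size_winv !size_wpow; lia.
have hiM : i <= M * size d by nia.
have /esym := congr1 (take (size p + size s + i)) e3.
have -> : take (size p + size s + i) (p' ++ s') = pref c (size p + size s + i).
  rewrite -(@take_wpow c (m + M)) // ?e1 ?takel_cat //.
  by move/(congr1 size): e1; rewrite size_cat size_wpow; lia.
rewrite catA take_cat size_cat ltnNge leq_addr /= addKn take_wpow // => ->.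
have := fps 0%N; rewrite cats0 addn0 => fps0.
by rewrite fw_cat fps0 xdM.
Qed.

(** A weak form of the Fine-Wilf theorem: the common prefix spells both c d and d c. *)
Lemma pref_commute c d : 0 < size c -> 0 < size d ->
    pref c (size c + size d) = pref d (size c + size d) ->
  fw c * fw d = fw d * fw c.
Proof.
move=> c0 d0 e; have pp v : 0 < size v -> pref v (size v) = v.
  by move=> v0; rewrite -{1}(mul1n (size v)) pref_wpow // wpow1.
have ec : pref c (size c) = pref d (size c).
  by rewrite -(@take_pref c _ (size c + size d)) ?leq_addr // e take_pref ?leq_addr.
have ed : pref c (size d) = pref d (size d).
  by rewrite -(@take_pref c _ (size c + size d)) ?leq_addl // e take_pref ?leq_addl.
have := congr1 (@fw I) e; rewrite {1}addnC fw_prefS // ed pp //.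
by rewrite fw_prefS // -ec pp.
Qed.

End PeriodicWords.

(** * Centralizers in free groups *)

Section Centralizers.
Variable I : choiceType.
Implicit Types (u v w c d : seq (I * bool)) (x y z r : fg I) (i j k m n : nat).

Lemma cyclic_core w : w != [::] -> reduced w ->
  exists v c : seq (I * bool), w = v ++ c ++ winv v /\ cycred c.
Proof.
have [n] := ubnP (size w); elim: n w => // n IH [//|l w] sn _.
case/lastP: w sn => [_ _|w t].
  by exists [::], [:: l]; split=> //; rewrite /cycred /reduced /= eq_sym linv_neq.
rewrite [size _]/= size_rcons => sn rlw; have [tl|tl] := eqVneq t (linv l); last first.
  exists [::], (l :: rcons w t); split; first by rewrite /= cats0.
  rewrite /cycred reduced_cat rlw andTb [junction _ _]/= last_rcons.
  by apply: contra tl => /eqP ->; rewrite linvK.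
have rw : reduced w.
  by move: rlw; rewrite -cat1s reduced_cat -cats1 reduced_cat => /and3P[_ /and3P[]].
have w0 : w != [::].
  by apply: contraL rlw => /eqP->; rewrite /reduced /= tl eqxx.
have [|v [c [-> cc]]] := IH w _ w0 rw; first by lia.
exists (l :: v), c; split=> //.
by rewrite winv_cons /= !rcons_cat tl.
Qed.

Lemma conj_core x : x <> 1 ->
  exists g (c : seq (I * bool)), cycred c /\ x = g * fw c * g^-1.
Proof.
move=> x1; have [||v [c [e cc]]] := @cyclic_core (nf x).
- by apply/eqP => e; apply: x1; rewrite -(nfK x) e.
- exact: nf_reduced.
by exists (fw v), c; split=> //; rewrite -(nfK x) e !fw_cat fw_inv mulgA.
Qed.

Lemma conjXV (G : groupType) (g a : G) n :
  (g * a * g^-1) ^+ n = g * a ^+ n * g^-1.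
Proof. by have := conjXg a g^-1 n; rewrite /conjg !invgK !mulgA. Qed.

Lemma fg_torsion_free x n : 0 < n -> x ^+ n = 1 -> x = 1.
Proof.
move=> n0 xn; apply: contrapT => /conj_core[g [c [cc xE]]].
have c0 := cycred_size cc; move: xn; rewrite xE conjXV => e.
have : fw (wpow c n) = 1.
  by apply: (mulgI g); apply: (mulIg g^-1); rewrite fw_wpow e mulg1 mulgV.
move/(fw_eq1 (reduced_wpow n cc))/(congr1 size); rewrite size_wpow /=; lia.
Qed.

(** Up to conjugation, [z] is given by a cyclically reduced [c]. An element commuting with it, times
    a power of [c], shifts the ray c c c ... along itself ([P k] for a shift by [k]). The least
    positive shift divides all the others and yields the root [r]; the pair [m], [n] encodes an
    integral exponent. *)
Lemma centralizer_cyclic z : z <> 1 ->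
  exists r, forall u : fg I, u * z = z * u -> exists m n, u = r ^+ m * r ^- n.
Proof.
move=> /conj_core[g [c [cc zE]]]; have c0 := cycred_size cc.
pose P k := forall i, fw (pref c k) * fw (pref c i) = fw (pref c (k + i)).
have Pc : P (size c).
  by move=> i; rewrite [in RHS]addnC fw_prefS // -{1}(mul1n (size c)) pref_wpow // wpow1.
have exP : exists k, `[< 0 < k /\ P k >] by exists (size c); apply/asboolP.
case: (ex_minnP exP) => k0 /asboolP[k00 Pk0] min.
set r0 := fw (pref c k0).
have r0X q j : r0 ^+ q * fw (pref c j) = fw (pref c (q * k0 + j)).
  elim: q => [|q IH]; first by rewrite mul1g.
  by rewrite expgS -mulgA IH Pk0 mulSn addnA.
have Pdvd k : P k -> exists q, fw (pref c k) = r0 ^+ q.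
  move=> Pk; exists (k %/ k0)%N; have := divn_eq k k0.
  set q := (k %/ k0)%N; set k' := (k %% k0)%N => kE.
  have Pk' : P k'.
    move=> i; apply: (mulgI (r0 ^+ q)); rewrite mulgA !r0X -kE Pk.
    by rewrite addnA -kE.
  have k'0 : k' = 0%N.
    apply/eqP/negP => /negP; rewrite -lt0n => k'0.
    have : k0 <= k' by apply: min; apply/asboolP.
    by rewrite leqNgt ltn_pmod.
  by rewrite kE -r0X k'0 mulg1.
have [qc qcE] := Pdvd _ Pc; have cE : fw c = r0 ^+ qc.
  by rewrite -qcE -{1}(wpow1 c) -pref_wpow // mul1n.
exists (g * r0 * g^-1) => u uz.
pose u' := g^-1 * u * g.
have u'c : u' * fw c = fw c * u'.
  have -> : fw c = g^-1 * z * g by rewrite zE !mulgA mulVg mul1g mulgVK.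
  rewrite /u' !mulgA; congr (_ * _); rewrite -!mulgA; congr (_ * _).
  by rewrite !mulVKg.
have [_ [m [k hk]]] := conj_cycred cc cc u'c.
have u'E : fw c ^+ m * u' = fw (pref c k) by have := hk 0%N; rewrite addn0 mulg1.
have Pk : P k by move=> i; rewrite -u'E hk.
have [q qE] := Pdvd _ Pk; exists q, (qc * m)%N.
rewrite !conjXV expgnA -cE -qE -u'E invgM invgM invgK.
have comm : fw c ^+ m * u' = u' * fw c ^+ m.
  exact/commute_sym/commuteX.
by rewrite comm /u' !mulgA mulgV mul1g mulgVK !mulgK.
Qed.

Lemma centralizer_abelian (z u v : fg I) : z <> 1 -> u * z = z * u -> v * z = z * v ->
  u * v = v * u.
Proof.
move=> /centralizer_cyclic[r rP] /rP[m [n ->]] /rP[m' [n' ->]].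
have rr i j : commute (r ^+ i) (r ^+ j).
  exact: commuteX2.
have rV i j : commute (r ^+ i * r ^- j) r.
  apply/commute_sym/commuteM; first exact: commuteX.
  exact/commuteV/commuteX.
by apply: commuteM; [exact: commuteX|apply/commuteV/commuteX].
Qed.

(** Both roots commute with the common power, hence with each other, so that their quotient is
    torsion. *)
Lemma fg_root_uniq x y n : 0 < n -> x ^+ n = y ^+ n -> x = y.
Proof.
move=> n0 e; have [x1|x1] := pselect (x ^+ n = 1).
  by rewrite (fg_torsion_free n0 x1); symmetry; apply: (fg_torsion_free n0); rewrite -e.
have xy : commute x y.
  apply: (@centralizer_abelian (x ^+ n)) => //; first exact: commuteX.
  by rewrite e; exact: commuteX.
apply: divg1_eq; apply: (fg_torsion_free n0).
by rewrite expgnFl // e mulgV.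
Qed.

(** If [y] inverted [x], then [y ^+ 2] would commute with both; centralizers being abelian, [x]
    would commute with [y] and so equal its own inverse. *)
Lemma conj_neqV x y : x <> 1 -> y * x * y^-1 <> x^-1.
Proof.
move=> x1 e; have yx : y * x = x^-1 * y by rewrite -e mulgVK.
have y1 : y ^+ 2 <> 1.
  move=> /(fg_torsion_free (isT : 0 < 2)) y1.
  move: e; rewrite y1 mul1g invg1 mulg1 => e.
  by apply: x1; apply: (@fg_torsion_free x 2) => //; rewrite expg2 {2}e mulgV.
have : y * x = x * y.
  apply: (@centralizer_abelian (y ^+ 2)) => //; first exact: commuteX.
  have xy : x * y = y * x^-1.
    by apply: (mulIg x); rewrite mulgVK -mulgA yx mulgA mulgV mul1g.
  by rewrite expg2 mulgA xy -!mulgA yx.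
rewrite yx => /mulIg xV.
by apply: x1; apply: (@fg_torsion_free x 2) => //; rewrite expg2 -{2}xV mulgV.
Qed.

End Centralizers.

(** * Overlapping axes *)

Section Runs.
Variable I : choiceType.
Implicit Types (u v w a c d : seq (I * bool)) (x y z b : fg I) (i j k m n : nat).

(* [b] is [fw (v ++ c ++ winv v)], whose axis branches off the axis of [a] at the
   origin. *)
Definition branches a b v c := [/\ b = fw (v ++ c ++ winv v),
  reduced (v ++ c ++ winv v), cycred c, v != [::] &
  junction a v && junction (winv a) v].

(** Either the axis of [b] passes through the origin and its translation length is at most that of
    [a], or it is joined to the axis of [a] by the bridge [v]. *)
Definition dominated a b :=
  (exists c, [/\ cycred c, b = fw c & size c <= size a]) \/
  (exists v c, branches a b v c).

Lemma winv_nil : winv [::] = [::] :> seq (I * bool).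
Proof. by []. Qed.

Lemma branchesV a b v c : branches a b v c -> branches (winv a) b^-1 v (winv c).
Proof.
case=> -> r cc v0 /andP[j1 j2]; split=> //; rewrite ?cycred_winv ?winvK ?j1 ?j2 //.
  by rewrite -fw_inv !winv_cat winvK catA.
by rewrite -reduced_winv !winv_cat !winvK -catA.
Qed.

Lemma dominatedV a b : dominated a b -> dominated (winv a) b^-1.
Proof.
case=> [[c [cc -> s]]|[v [c /branchesV h]]]; last by right; exists v, (winv c).
by left; exists (winv c); rewrite cycred_winv fw_inv !size_winv.
Qed.

Lemma junction_cat u v w : v != [::] -> junction u (v ++ w) = junction u v.
Proof. by case: u v => // x u [|y v]. Qed.

Lemma junction_catl u v w : v != [::] -> junction (u ++ v) w = junction v w.
Proof. by case: u => [|x u]; case: v => // y v _; case: w => //= z w; rewrite last_cat. Qed.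

Lemma junction_winv u v : junction (winv v) (winv u) = junction u v.
Proof.
case/lastP: u => [|u x]; first by rewrite winv_nil; case: (winv v).
case: v => [|y v]; first by rewrite winv_nil; case: rcons.
rewrite winv_rcons winv_cons !junctionP linvK.
by case: x y => i b [j b']; rewrite /linv !xpair_eqE /= eq_sym; case: b; case: b'.
Qed.

Lemma wpow_neq0 c n : cycred c -> 0 < n -> wpow c n != [::].
Proof. by move=> /cycred_size c0 n0; rewrite -size_eq0 size_wpow; nia. Qed.

Lemma junction_wpowl c n w : cycred c -> 0 < n ->
  junction (wpow c n) w = junction c w.
Proof.
case: n => // n cc _; rewrite wpowSr; apply: junction_catl.
by case/andP: cc.
Qed.

Lemma junction_wpowr c n w : cycred c -> 0 < n ->
  junction w (wpow c n) = junction w c.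
Proof.
by case: n => // n cc _; rewrite wpowS; apply: junction_cat; case/andP: cc.
Qed.

Lemma branches_reduced a b v c n n' m : cycred a -> branches a b v c -> 0 < m ->
  reduced (wpow a n ++ v ++ wpow c m ++ winv v ++ wpow a n').
Proof.
move=> ca [_ r cc v0 /andP[jav jav']] m0.
have v0' : winv v != [::] by rewrite -size_eq0 size_winv size_eq0.
have [rv rc rv' jvc jcv] : [/\ reduced v, reduced c, reduced (winv v), junction v c
    & junction c (winv v)].
  move: r; rewrite !reduced_cat reduced_winv => /and3P[-> /and3P[-> _ ->]].
  by rewrite junction_cat //; case/andP: cc.
rewrite !reduced_cat rv rv' !reduced_wpow //=.
rewrite (@junction_cat v (wpow c m)) ?wpow_neq0 // (junction_wpowr _ cc m0) jvc.
rewrite (@junction_cat (wpow c m) (winv v)) // (junction_wpowl _ cc m0) jcv.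
rewrite (@junction_cat (wpow a n) v) // andbT.
have [->|n0] := posnP n; have [->|n0'] := posnP n'; rewrite ?andbT //=.
- by case: (winv v).
- by rewrite junction_wpowr // -[a]winvK junction_winv.
- by rewrite junction_wpowl // jav; case: (winv v).
by rewrite junction_wpowl // junction_wpowr // jav andbT -[a]winvK junction_winv.
Qed.

(** At most three copies of [a] cancel. In the branching case nothing cancels. Otherwise a longer
    cancellation would either make the rays of [winv a] and [c] agree long enough to commute, or
    make [b ^+ m] conjugate [fw a] to its inverse. *)
Lemma run_prefix a b m n n' : cycred a -> dominated a b -> fw a * b <> b * fw a ->
    0 < m -> 3 <= n ->
  take ((n - 3) * size a) (nf (fw a ^+ n * b ^+ m * fw a ^+ n')) = wpow a (n - 3).
Proof.
move=> ca dab nab m0 n3; have a0 := cycred_size ca.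
have tw : take ((n - 3) * size a) (wpow a n) = wpow a (n - 3).
  by rewrite take_wpow ?pref_wpow // leq_mul2r leq_subr orbT.
case: dab => [[c [cc bE sca]]|[v [c br]]]; last first.
  have -> : nf (fw a ^+ n * b ^+ m * fw a ^+ n') =
      wpow a n ++ v ++ wpow c m ++ winv v ++ wpow a n'.
    have [-> _ _ _ _] := br; rewrite -[RHS]fwK; last exact: branches_reduced br _.
    by rewrite !fw_cat fw_inv mulgA conjXV !fw_wpow !mulgA.
  by rewrite takel_cat // size_wpow leq_mul2r leq_subr orbT.
have c0 := cycred_size cc.
have [p1 [r1 [s1 [e1 e2 r12]]]] := cancellation (reduced_wpow m cc) (reduced_wpow n' ca).
have [p2 [r2 [s2 [e3 e4 r34]]]] := cancellation (reduced_wpow n ca) r12.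
have -> : nf (fw a ^+ n * b ^+ m * fw a ^+ n') = p2 ++ s2.
  rewrite -[RHS]fwK // bE -!fw_wpow -mulgA.
  have -> : fw (wpow c m) * fw (wpow a n') = fw (p1 ++ s1).
    by rewrite e1 e2 !fw_cat fw_inv -!mulgA mulVKg.
  by rewrite e4 e3 !fw_cat fw_inv -!mulgA mulVKg.
have sz : size p2 + size r2 = (n * size a)%N.
  by rewrite -size_wpow e3 size_cat.
have [r2s|r2l] := ltnP (size r2) (3 * size a).
  rewrite takel_cat; last by lia.
  have <- : take ((n - 3) * size a) (p2 ++ r2) = take ((n - 3) * size a) p2.
    by rewrite takel_cat //; lia.
  by rewrite -e3.
have va0 : 0 < size (winv a) by rewrite size_winv.
have pr2 i : i <= size r2 -> take i (p1 ++ s1) = pref (winv a) i.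
  move=> ir; rewrite e4 takel_cat ?size_winv // -(@take_wpow _ _ n) //; last first.
    by rewrite size_winv; lia.
  by rewrite -winv_wpow e3 winv_cat takel_cat // size_winv.
have prV i : fw (pref (winv a) (i + size a)) = (fw a)^-1 * fw (pref (winv a) i).
  by rewrite -{1}(size_winv a) fw_prefS // fw_inv.
(* The first [3 * size a] letters of [p1 ++ s1] follow the ray of [winv a]. Either [p1], a prefix of
   [wpow c m], is long enough for [pref_commute], or [size p1] is below [2 * size a] and a whole
   period of [a] in [s1] is also read along [winv a]. *)
exfalso; have [long|short] := leqP (size a + size c) (size p1).
  apply: nab; rewrite bE.
  have : fw (winv a) * fw c = fw c * fw (winv a).
    apply: pref_commute; rewrite ?size_winv // -pr2 ?takel_cat //; last by lia.
    rewrite -(@take_wpow _ c m) //; last by rewrite -size_wpow e1 size_cat; lia.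
    by rewrite e1 takel_cat.
  rewrite fw_inv => h; apply: (mulgI (fw a)^-1).
  by rewrite mulKg mulgA h mulgVK.
apply: (@conj_neqV _ (fw a) (b ^+ m)) => [a1|].
  by have := fw_eq1 (cycred_reduced ca) a1; move: a0; rewrite lt0n size_eq0 => /eqP.
have r1n : size r1 + size s1 = (n' * size a)%N.
  by rewrite -size_wpow e2 size_cat size_winv.
have s1l : size a <= size s1.
  by move/(congr1 size): e4; rewrite !size_cat size_winv; lia.
have xe : fw p1 = b ^+ m * fw (pref a (size r1)).
  rewrite bE -fw_wpow e1 -(@take_wpow _ a n') //; last by lia.
  by rewrite e2 -(size_winv r1) take_size_cat // fw_cat fw_inv mulgK.
have xe' : fw (take (size p1 + size a) (p1 ++ s1)) =
    b ^+ m * fw a * fw (pref a (size r1)).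
  rewrite take_cat ltnNge leq_addr /= addKn fw_cat xe -!mulgA; congr (_ * _).
  rewrite -fw_prefS // -fw_cat -(@take_wpow _ a n') //; last by lia.
  rewrite -(@take_wpow _ a n') //; last by lia.
  rewrite e2 -{1}(size_winv r1) take_size_cat // take_cat size_winv.
  by rewrite ltnNge leq_addr /= addKn.
apply: (mulIg (fw p1)).
move: xe'; rewrite pr2; last by lia.
rewrite prV -pr2; last by lia.
rewrite take_size_cat // => ->.
by rewrite {1}xe -!mulgA; congr (_ * _); rewrite mulKg.
Qed.

End Runs.

(** * Long runs in products of powers, and simultaneous normalization of two elements *)

Section LongRun.
Variable I : choiceType.
Implicit Types (u v w a c d : seq (I * bool)) (x y b h : fg I) (i j k m n : nat).

(** This is [a ^+ M * b ^+ m] conjugated by a power of [a]. Each block of copies of [a] loses at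
    most three; four are put in front so that one survives, and a word that begins and ends with the
    cyclically reduced [a] is cyclically reduced. *)
Lemma end_run a b m M : cycred a -> dominated a b -> fw a * b <> b * fw a ->
    0 < m -> 7 < M ->
  exists T z : seq (I * bool), [/\ cycred T, T = z ++ wpow a (M - 7) &
    fw T = fw a ^+ 4 * b ^+ m * fw a ^+ (M - 4)].
Proof.
move=> ca dab nab m0 M7; set x := _ * _ * _; set T := nf x.
have rT : reduced T := nf_reduced x.
have := @run_prefix _ a b m 4 (M - 4) ca dab nab m0 isT.
rewrite -/x -/T mul1n wpow1 => Ta.
have nab' : fw (winv a) * b^-1 <> b^-1 * fw (winv a).
  by rewrite fw_inv -!invgM => /invg_inj e; apply: nab.
have M4 : 3 <= M - 4 by lia.
have cwa : cycred (winv a) by rewrite cycred_winv.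
have := run_prefix 4 cwa (dominatedV dab) nab' m0 M4.
have -> : nf (fw (winv a) ^+ (M - 4) * b^-1 ^+ m * fw (winv a) ^+ 4) = winv T.
  rewrite -[RHS]fwK ?reduced_winv //; congr nf.
  by rewrite !fw_inv nfK !expVgn /x !invgM !mulgA.
have -> : (M - 4 - 3 = M - 7)%N by lia.
rewrite -winv_wpow => e.
exists T, (winv (drop ((M - 7) * size (winv a)) (winv T))).
have TE : T = winv (drop ((M - 7) * size (winv a)) (winv T)) ++ wpow a (M - 7).
  rewrite -[T in LHS]winvK -(cat_take_drop ((M - 7) * size (winv a)) (winv T)).
  by rewrite winv_cat e winvK drop_size_cat // size_winv size_wpow size_winv.
split=> //; last by rewrite nfK.
have T0 : T != [::].
  apply/eqP => T0; move: Ta; rewrite T0 => /esym a0.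
  by move: (cycred_size ca); rewrite a0.
rewrite /cycred T0 reduced_cat rT /= {1}TE junction_catl ?wpow_neq0 ?subn_gt0 //.
rewrite junction_wpowl ?subn_gt0 // -(cat_take_drop (size a) T) Ta junction_cat.
  by case/andP: ca => _; rewrite reduced_cat => /and3P[].
by case/andP: ca.
Qed.

Lemma nf_fw w : nf (fw w) = reduce w.
Proof. exact/reduce_equiv/repr_pi. Qed.

Lemma size_reduce w : size (reduce w) <= size w.
Proof.
elim: w => // l w; rewrite /= /rstep; case: reduce => //= m u IH.
by case: eqP => _ /=; lia.
Qed.

(** The conjugator minimizes first the length of the conjugate of [x], then that of [y]. When the
    conjugate of [y] is not cyclically reduced, the bridge [v] leaves the axis of [a] at once, since
    otherwise a rotation of [a] would shorten the conjugate of [y]. *)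
Lemma align x y : x <> 1 -> y <> 1 -> exists h a (b : fg I),
  [/\ cycred a, x = h * fw a * h^-1, y = h * b * h^-1 &
    (exists2 c, cycred c & b = fw c) \/ exists v c, branches a b v c].
Proof.
move=> x1 y1.
have cnj1 (z h : fg I) : z <> 1 -> nf (h^-1 * z * h) != [::].
  move=> z1; apply/eqP => e; apply: z1; apply: (mulgI h^-1); apply: (mulIg h).
  by rewrite -[LHS]nfK e mulg1 mulVg.
pose P1 n := exists h, size (nf (h^-1 * x * h)) = n.
have ex1 : exists n, `[< P1 n >] by eexists; apply/asboolP; exists 1.
case: (ex_minnP ex1) => n1 /asboolP hP1 min1.
pose P2 n := exists h, size (nf (h^-1 * x * h)) = n1 /\ size (nf (h^-1 * y * h)) = n.
have ex2 : exists n, `[< P2 n >].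
  by case: hP1 => h hh; eexists; apply/asboolP; exists h; split=> //.
case: (ex_minnP ex2) => n2 /asboolP[h [h1 h2]] min2.
have {}min1 g w : g^-1 * x * g = fw w -> n1 <= size w.
  move=> e; apply: leq_trans (size_reduce w); rewrite -nf_fw -e.
  by apply: min1; apply/asboolP; exists g.
have {}min2 g w w' : g^-1 * x * g = fw w -> size w <= n1 ->
    g^-1 * y * g = fw w' -> n2 <= size w'.
  move=> e le e'; apply: leq_trans (size_reduce w'); rewrite -nf_fw -e'.
  apply: min2; apply/asboolP; exists g; split=> //; apply/eqP; rewrite eqn_leq.
  rewrite e nf_fw (leq_trans (size_reduce w)) //= -nf_fw.
  by apply: (min1 g); rewrite nfK.
set a := nf (h^-1 * x * h) in h1; set w := nf (h^-1 * y * h) in h2.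
have aE : h^-1 * x * h = fw a by rewrite nfK.
have wE : h^-1 * y * h = fw w by rewrite nfK.
have cE z g : (h * g)^-1 * z * (h * g) = g^-1 * (h^-1 * z * h) * g.
  by rewrite invgM !mulgA.
have ca : cycred a.
  have [v [c [e cc]]] := cyclic_core (cnj1 x h x1) (nf_reduced _).
  suff v0 : v = [::] by rewrite /a e v0 /= cats0.
  have := min1 (h * fw v) c; rewrite cE aE [in X in X -> _]/a e !fw_cat fw_inv.
  rewrite !mulgA mulVg mul1g mulgVK => /(_ erefl).
  rewrite -h1 /a e !size_cat size_winv => le; apply: size0nil; lia.
exists h, a, (fw w); split=> //.
- by rewrite -aE !mulgA mulgV mul1g mulgK.
- by rewrite -wE !mulgA mulgV mul1g mulgK.
have [v [c [e cc]]] := cyclic_core (cnj1 y h y1) (nf_reduced _).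
rewrite -/w in e; have [v0|v0] := eqVneq v [::].
  by left; exists c => //; rewrite e v0 /= cats0.
right; exists v, c; rewrite /branches -e v0; split=> //; first exact: nf_reduced.
case: v v0 e => // l v _ e.
(* Conjugating by the first letter [l] of [v] would keep the length of [a] and remove two letters
   from [w]. *)
have rot a' : (fw [:: l])^-1 * fw a * fw [:: l] = fw a' -> size a' = size a -> False.
  move=> ea sa; have := min2 (h * fw [:: l]) a' (v ++ c ++ winv v).
  rewrite !cE aE wE ea sa h1 leqnn => /(_ erefl isT).
  rewrite e -(cat1s l v) -h2 e winv_cat !fw_cat !fw_inv !mulgA mulVg mul1g mulgVK.
  move=> /(_ erefl); rewrite !size_cat !size_winv /=; lia.
apply/andP; split; apply/negPn/negP => jn.
  case/lastP: (a) jn rot => // a' t; rewrite junctionP negbK => /eqP -> rot.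
  apply: (rot (linv (linv t) :: a')); last by rewrite size_rcons.
  rewrite linvK -cats1 -[t :: a']cat1s !fw_cat.
  have -> : fw [:: linv t] = (fw [:: t])^-1 by rewrite -fw_inv.
  by rewrite invgK mulgA mulgK.
case: (a) jn rot => [|t a']; first by case: v {e}.
rewrite winv_cons junctionP negbK linvK => /eqP -> rot.
apply: (rot (rcons a' t)); last by rewrite size_rcons.
by rewrite -cats1 -[t :: a']cat1s !fw_cat mulKg.
Qed.

End LongRun.

(** * The axis of a product of two large powers *)

Section Axis.
Variable I : choiceType.
Implicit Types (u v w a c d : seq (I * bool)) (x y b h g Q : fg I) (i j k m n : nat).

(** A longer cancellation would make the rays of [winv a] and [c] agree far enough for
    [pref_commute]. *)
Lemma cancel_bound a c m n p r s : cycred a -> cycred c ->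
    fw a * fw c <> fw c * fw a ->
    wpow a m = p ++ r -> wpow c n = winv r ++ s ->
  size r < size a + size c.
Proof.
move=> ca cc nac e1 e2; rewrite ltnNge; apply/negP => le; apply: nac.
have a0 := cycred_size ca; have c0 := cycred_size cc.
have va0 : 0 < size (winv a) by rewrite size_winv.
have : fw (winv a) * fw c = fw c * fw (winv a).
  apply: pref_commute => //; rewrite size_winv.
  rewrite -(@take_wpow _ c n) //; last first.
    by rewrite -size_wpow e2 size_cat size_winv; lia.
  rewrite -(@take_wpow _ _ m) //; last first.
    by rewrite size_winv -size_wpow e1 size_cat; lia.
  by rewrite -winv_wpow e1 e2 winv_cat !takel_cat ?size_winv.
rewrite fw_inv => h; apply: (mulgI (fw a)^-1); rewrite mulKg mulgA h.
by rewrite mulgVK.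
Qed.

(** With [X] a path in the Cayley tree, [x] shifts the segment from [s] to [e] by [l], as it does
    along its axis. *)
Definition translates (X : nat -> fg I) x (l s e : nat) :=
  forall i, s <= i -> i + l <= e -> x * X i = X (i + l)%N.

(* Up to bounded gaps, a period of the axis of [y1 ^+ n1 * y2 ^+ n2] consists of
   a segment of the axis of [y1] and a segment of the axis of a conjugate of [y2]. *)
Lemma two_runs (y1 y2 : fg I) : y1 * y2 <> y2 * y1 ->
  exists l1 l2 C : nat, [/\ 0 < l1, 0 < l2 & forall n1 n2, C <= n1 -> C <= n2 ->
  exists Q c m1 k1 m2 k2, let w := y1 ^+ n1 * y2 ^+ n2 in
  [/\ cycred c /\ w = Q * fw c * Q^-1,
      size c = (m1 + k1 + m2 + k2)%N /\ k1 + k2 <= C,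
      m1 <= n1 * l1 /\ m2 <= n2 * l2,
      translates (fun i => Q * fw (pref c i)) y1 l1 0 m1 &
      translates (fun i => Q * fw (pref c i)) (w * y2 * w^-1) l2
        (m1 + k1) (m1 + k1 + m2)]].
Proof.
move=> ny; have [|] := pselect (y1 = 1); first by move=> y; case: ny; rewrite y mul1g mulg1.
have [|] := pselect (y2 = 1); first by move=> y; case: ny; rewrite y mul1g mulg1.
move=> y2n y1n; have [h [a [b [ca y1E y2E br]]]] := align y1n y2n.
have a0 := cycred_size ca.
have nab : fw a * b <> b * fw a.
  move=> e; apply: ny; rewrite y1E y2E !mulgA !mulgVK -!(mulgA h) e.
  by [].
(* [M1] and [M2] are what remains of the two powers in the cyclic word [c], and [z1], [z2] are the
   gaps; [q1] and [q2] are the phases at which the runs start. *)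
suff [l2 [C [l20 hC]]] : exists l2 C : nat, 0 < l2 /\ forall n1 n2, C <= n1 -> C <= n2 ->
  exists Q c M1 z1 M2 z2 g c2 q1 q2, let w := y1 ^+ n1 * y2 ^+ n2 in
  [/\ cycred c /\ w = Q * fw c * Q^-1,
      c = M1 ++ z1 ++ M2 ++ z2 /\ size z1 + size z2 <= C,
      size M1 <= n1 * size a /\ size M2 <= n2 * l2,
      forall j, j <= size M1 -> Q * fw (take j M1) = h * fw (pref a (q1 + j)) &
      (forall j, j <= size M2 ->
         Q * fw (M1 ++ z1 ++ take j M2) = g * fw (pref c2 (q2 + j)))
      /\ [/\ w * y2 * w^-1 = g * fw c2 * g^-1, size c2 = l2 & 0 < l2]].
  exists (size a), l2, C; split=> // n1 n2 N1 N2.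
  have [Q [c [M1 [z1 [M2 [z2 [g [c2 [q1 [q2 []]]]]]]]]]] := hC n1 n2 N1 N2.
  move=> [cc wE] [cE zC] mm r1 [r2 [gE s2 _]].
  exists Q, c, (size M1), (size z1), (size M2), (size z2).
  split=> //; first by rewrite cE !size_cat !addnA.
    move=> i _ le.
    have pr j : j <= size M1 -> pref c j = take j M1.
      by move=> jm; rewrite -(@take_wpow _ c 1) ?cycred_size ?wpow1 // ?cE ?takel_cat //;
        rewrite -?cE ?cycred_size // mul1n cE size_cat; lia.
    rewrite !pr; [|lia|lia]; rewrite !r1; [|lia|lia].
    by rewrite y1E mulgA mulgVK -mulgA -fw_prefS // addnA.
  move=> i ge le; have [j jE] : exists j, i = (size M1 + size z1 + j)%N.
    by exists (i - (size M1 + size z1))%N; lia.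
  have pr k : k <= size M2 ->
      pref c (size M1 + size z1 + k) = M1 ++ z1 ++ take k M2.
    move=> jm; rewrite -(@take_wpow _ c 1) ?cycred_size ?wpow1 //; last first.
      by rewrite mul1n cE !size_cat; lia.
    rewrite cE catA take_cat size_cat ltnNge leq_addr /= addKn.
    by rewrite takel_cat // -catA.
  have -> : (i + l2 = size M1 + size z1 + (j + l2))%N by lia.
  rewrite jE !pr; [|lia|lia]; rewrite !r2; [|lia|lia].
  by rewrite gE mulgA mulgVK -mulgA -s2 -fw_prefS ?s2 // addnA.
(* When the axes branch, nothing cancels and the gaps are the two passages along [v]. *)
case: br => [[c cc bE]|[v [c br]]]; last first.
  exists (size c), (size v + size v).+1; split; first by case: br => _ _ /cycred_size.
  move=> n1 n2 N1 N2; have n20 : 0 < n2 by lia.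
  have n10 : 0 < n1 by lia.
  have [bE _ cc v0 _] := br; have c0 := cycred_size cc.
  have wE : y1 ^+ n1 * y2 ^+ n2 =
      h * fw (wpow a n1 ++ v ++ wpow c n2 ++ winv v) * h^-1.
    have bX : b ^+ n2 = fw (v ++ wpow c n2 ++ winv v).
      by rewrite bE !fw_cat fw_inv fw_wpow mulgA conjXV !mulgA.
    by rewrite y1E y2E !conjXV bX -fw_wpow (fw_cat (wpow a n1)) !mulgA mulgVK.
  exists h, (wpow a n1 ++ v ++ wpow c n2 ++ winv v), (wpow a n1), v, (wpow c n2), (winv v).
  exists (h * fw (wpow a n1) * fw v), c, 0%N, 0%N; split.
  - split=> //; have := branches_reduced n1 n1 ca br n20.
    set X := wpow a n1 ++ _ ++ _ ++ winv v => r.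
    have {}r : reduced (X ++ wpow a n1) by rewrite /X -!catA.
    move: r; rewrite /cycred !reduced_cat => /and3P[-> _].
    rewrite /X [in X in _ -> X]junction_cat ?wpow_neq0 // => -> /=.
    by rewrite -size_eq0 !size_cat size_wpow; nia.
  - by split=> //; rewrite size_winv; lia.
  - by rewrite !size_wpow.
  - by move=> j jm; rewrite take_wpow -?size_wpow.
  - split=> [j jm|]; first by rewrite take_wpow -?size_wpow // !fw_cat !mulgA.
    split=> //; rewrite wE y2E bE !fw_cat !fw_wpow fw_inv !invgM !invgK !mulgA.
    by rewrite !mulgVK -(mulgA _ (fw c ^+ n2) (fw c)) -expgSr expgS mulgA mulgK.
have c0 := cycred_size cc.
exists (size c), (size a + size c + (size a + size c)).+1; split=> // n1 n2 N1 N2.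
have nac : fw a * fw c <> fw c * fw a by rewrite -bE.
have nca : fw c * fw a <> fw a * fw c by move=> e; apply: nac.
(* Both junctions of the cyclic word are cancelled: [P] where the power of [a] meets that of [c],
   and [r] where the power of [c] meets the next power of [a]. The cores [M1] and [M2] remain, with
   no gaps. *)
have [M [P [M' [e1 e2 rM]]]] := cancellation (reduced_wpow n1 ca) (reduced_wpow n2 cc).
have [p [r [s [e3 e4 rp]]]] := cancellation (reduced_wpow n2 cc) (reduced_wpow n1 ca).
have sP := cancel_bound ca cc nac e1 e2.
have sr := cancel_bound cc ca nca e3 e4.
have sMP : (size M + size P = n1 * size a)%N by rewrite -size_wpow e1 size_cat.
have sPM : (size P + size M' = n2 * size c)%N by rewrite -size_wpow e2 size_cat size_winv.
have MN : size a + size c < size M by nia.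
have MN' : size a + size c < size M' by nia.
have [M1 ME] : exists M1, M = winv r ++ M1.
  exists (drop (size r) M); rewrite -[M in LHS](cat_take_drop (size r)); congr (_ ++ _).
  have := congr1 (take (size r)) e1; rewrite e4 takel_cat; last by lia.
  by rewrite -(size_winv r) take_size_cat // => ->.
have [M2 M'E] : exists M2, M' = M2 ++ r.
  exists (take (size M' - size r) M').
  rewrite -[M' in LHS](cat_take_drop (size M' - size r)); congr (_ ++ _).
  have sp : size p = (size (winv P) + (size M' - size r))%N.
    by move/(congr1 size): e3; rewrite e2 !size_cat size_winv; lia.
  have := congr1 (drop (size p)) e3; rewrite drop_size_cat // e2 sp => h'.
  by rewrite -[RHS]h' drop_cat ltnNge leq_addr /= addKn.
have pE : p = winv P ++ M2.
  have : p ++ r = (winv P ++ M2) ++ r by rewrite -e3 e2 M'E catA.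
  have spn : size p = (size P + size M2)%N.
    by move: sPM; rewrite M'E size_cat -size_wpow e3 size_cat; lia.
  have sp : size p = size (winv P ++ M2) by rewrite spn size_cat size_winv.
  by move/(congr1 (take (size p))); rewrite !take_size_cat.
have sE : s = M1 ++ P.
  have : winv r ++ s = winv r ++ M1 ++ P by rewrite -e4 e1 ME catA.
  by move/eqP; rewrite eqseq_cat // eqxx => /eqP.
have M10 : M1 != [::].
  by apply/eqP => M0; move: MN; rewrite ME M0 size_cat size_winv /=; lia.
have M20 : M2 != [::].
  by apply/eqP => M0; move: MN'; rewrite M'E M0 size_cat /=; lia.
have r12 : reduced (M1 ++ M2).
  move: rM; rewrite ME M'E -catA reduced_cat => /and3P[_ + _].
  by rewrite catA reduced_cat => /and3P[].
have r21 : reduced (M2 ++ M1).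
  move: rp; rewrite pE sE -catA reduced_cat => /and3P[_ + _].
  by rewrite catA reduced_cat => /and3P[].
have hM : fw (winv r) * fw M1 = fw a ^+ n1 * fw (winv P).
  by rewrite -fw_cat -ME -fw_wpow e1 fw_cat fw_inv mulgK.
have wE : y1 ^+ n1 * y2 ^+ n2 = h * fw (winv r) * fw (M1 ++ M2) * (h * fw (winv r))^-1.
  have core : fw a ^+ n1 * fw c ^+ n2 =
      fw (winv r) * fw (M1 ++ M2) * (fw (winv r))^-1.
    rewrite fw_cat mulgA hM -fw_inv winvK -!mulgA; congr (_ * _).
    by rewrite -fw_wpow e2 M'E !fw_cat.
  by rewrite y1E y2E bE !conjXV invgM !mulgA mulgVK -(mulgA h) core !mulgA.
exists (h * fw (winv r)), (M1 ++ M2), M1, [::], M2, [::].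
exists (h * fw a ^+ n1), c, (size r), (size P); split.
- split=> //; apply/andP; split.
    by rewrite -size_eq0 size_cat addn_eq0 !size_eq0 (negPf M10).
  by rewrite -catA; do 2 apply: reduced_cat3 => //.
- by rewrite cats0.
- by move: sMP sPM; rewrite ME M'E !size_cat size_winv; lia.
- move=> j jm; rewrite -mulgA -fw_cat; congr (_ * fw _).
  rewrite -(@take_wpow _ a n1) //; last first.
    by move: sMP; rewrite ME size_cat size_winv; lia.
  rewrite e1 ME -catA take_cat size_winv ltnNge leq_addr /= addKn.
  by rewrite takel_cat.
split=> [j jm|].
  rewrite cat0s -!mulgA fw_cat (mulgA (fw (winv r))) hM; congr (_ * _).
  rewrite -mulgA -fw_cat; congr (_ * fw _).
  rewrite -(@take_wpow _ c n2) //; last first.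
    by move: sPM; rewrite M'E size_cat; lia.
  rewrite e2 M'E take_cat size_winv ltnNge leq_addr /= addKn.
  by rewrite takel_cat.
split=> //; rewrite y1E y2E bE !conjXV !invgM !invgK !mulgA !mulgVK.
by rewrite -(mulgA _ (fw c ^+ n2) (fw c)) -expgSr expgS mulgA mulgK.
Qed.

(** The interval from [s] to [s + R] starts in the first period and is no longer than a period. It
    thus overlaps at most three segments, and the gaps in it have total length at most
    [2 * (k1 + k2)], so some overlap has length at least [L]. *)
Lemma interval_pigeonhole (m1 k1 m2 k2 s R L : nat) :
    s < m1 + k1 + m2 + k2 -> R <= m1 + k1 + m2 + k2 ->
    4 * L + 2 * (k1 + k2) <= R ->
  exists j t, s <= j /\ j + L <= s + R /\
    let o := (t * (m1 + k1 + m2 + k2))%N in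
    (o <= j /\ j + L <= o + m1 \/ o + m1 + k1 <= j /\ j + L <= o + m1 + k1 + m2).
Proof.
move=> hs hR hL.
have [h1|h1] := leqP (s + L) m1; first by exists s, 0%N => /=; lia.
have [h2|h2] := leqP (maxn s (m1 + k1) + L) (m1 + k1 + m2).
  by have [?|?] := leqP (maxn s (m1 + k1) + L) (s + R);
    [exists (maxn s (m1 + k1)), 0%N => /=; lia|exfalso; lia].
have [h3|h3] := leqP L m1.
  by have [?|?] := leqP (m1 + k1 + m2 + k2 + L) (s + R);
    [exists (m1 + k1 + m2 + k2)%N, 1%N => /=; lia|exfalso; lia].
exists (m1 + k1 + m2 + k2 + m1 + k1)%N, 1%N => /=; lia.
Qed.

End Axis.

(** * Elements whose axes share a long segment *)

Section Meeting.
Variable I : choiceType.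
Implicit Types (u v a c d : seq (I * bool)) (w x y b h g Q : fg I) (i j k m n : nat).

(** Both products send [X j] to [X (j + (l + l'))], and left multiplication is free. *)
Lemma translates_commute (X : nat -> fg I) x y l l' s e s' e' j :
    translates X x l s e -> translates X y l' s' e' ->
    s <= j -> s' <= j -> j + (l + l') <= e -> j + (l + l') <= e' ->
  commute x y.
Proof.
move=> tx ty h1 h2 h3 h4; apply: (mulIg (X j)); rewrite -!mulgA.
rewrite ty; [|lia|lia]; rewrite tx; [|lia|lia]; rewrite tx; [|lia|lia].
rewrite ty; [|lia|lia].
by congr X; lia.
Qed.

(** The axis of [w] carries runs for conjugates of [y1] and [y2], and a run of [d] for a conjugate
    of [x]. By [interval_pigeonhole] the latter shares with one of the former a segment long enough
    for [translates_commute]. *)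
Lemma run_meets w y1 y2 x Q c m1 k1 m2 k2 (l1 l2 : nat) g (T z d : seq (I * bool)) r :
    cycred c -> w = Q * fw c * Q^-1 -> size c = (m1 + k1 + m2 + k2)%N ->
    translates (fun i => Q * fw (pref c i)) y1 l1 0 m1 ->
    translates (fun i => Q * fw (pref c i)) (w * y2 * w^-1) l2
        (m1 + k1) (m1 + k1 + m2) ->
    cycred T -> cycred d -> T = z ++ wpow d r ->
    x = g * fw d * g^-1 -> w = g * fw T * g^-1 ->
    4 * (size d + maxn l1 l2) + 2 * (k1 + k2) <= r * size d ->
  size T = size c /\ exists e f, commute (w ^+ e * x * w ^- e) (w ^+ f * y1 * w ^- f) \/
    commute (w ^+ e * x * w ^- e) (w ^+ f * y2 * w ^- f).
Proof.
move=> cc wE cE t1 t2 cT cd TE xE wE' hR.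
have c0 := cycred_size cc; have T0 := cycred_size cT; have d0 := cycred_size cd.
set X := fun i => Q * fw (pref c i).
have Xw t i : X (t * size c + i)%N = w ^+ t * X i.
  by rewrite /X fw_prefD // wE conjXV !mulgA mulgVK.
have shift t y l s e : translates X y l s e ->
    translates X (w ^+ t * y * w ^- t) l (t * size c + s) (t * size c + e).
  move=> ty i h1 h2; have [j jE] : exists j, i = (t * size c + j)%N.
    by exists (i - t * size c)%N; lia.
  rewrite jE -addnA !Xw mulgA mulgVK -mulgA ty //; lia.
have uT : (Q^-1 * g) * fw T = fw c * (Q^-1 * g).
  apply: (mulgI Q); apply: (mulIg g^-1).
  by rewrite !mulgA mulgV mul1g -wE' mulgK wE.
have [sT [m [k hk]]] := conj_cycred cc cT uT; split; first by rewrite sT.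
(* Once the two parametrizations of the axis of [w] are matched by [hk], the run of [d] begins at
   position [q]. *)
pose q := (k + size z)%N.
have hx : translates X (w ^+ m.+1 * x * w ^- m.+1) (size d) q (q + r * size d).
  have gX i : w ^+ m * g * fw (pref T i) = X (k + i)%N.
    by rewrite /X -hk wE conjXV !mulgA.
  have pT j : j <= r * size d -> pref T (size z + j) = z ++ pref d j.
    move=> jr; rewrite -(@take_wpow _ T 1) // ?wpow1; last first.
      by rewrite mul1n TE size_cat size_wpow leq_add2l.
    rewrite TE take_cat ltnNge leq_addr /= addKn take_wpow //.
  move=> i h1 h2; have [j jE] : exists j, i = (q + j)%N by exists (i - q)%N; lia.
  rewrite jE /q -!addnA -!gX !pT ?fw_cat; [|lia|lia].
  have -> : w ^+ m.+1 * x * w ^- m.+1 = w ^+ m * (g * fw z * fw d * (g * fw z)^-1) * w ^- m.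
    have <- : w * x * w^-1 = g * fw z * fw d * (g * fw z)^-1.
      rewrite xE wE' TE fw_cat fw_wpow !invgM !invgK !mulgA !mulgVK.
      by rewrite -(mulgA _ (fw d ^+ r) (fw d)) -expgSr expgS !mulgA !mulgK.
    by rewrite expgSr invgM !mulgA.
  by rewrite fw_prefS // !invgM !mulgA !mulgVK.
have := @interval_pigeonhole m1 k1 m2 k2 (q %% size c) (r * size d) (size d + maxn l1 l2).
rewrite -cE ltn_pmod // => /(_ isT).
have rT : r * size d <= size c.
  by rewrite sT TE size_cat size_wpow leq_addl.
move=> /(_ rT hR) [j [t [h1 [h2 /= h3]]]].
pose o := (q %/ size c)%N.
have qE : q = (o * size c + q %% size c)%N := divn_eq _ _.
exists m.+1; case: h3 => [[h3 h4]|[h3 h4]].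
  exists (o + t)%N; left.
  apply: (translates_commute (j := (o * size c + j)%N) hx (shift _ _ _ _ _ t1));
    rewrite ?mulnDl; lia.
exists (o + t).+1; right.
have -> : w ^+ (o + t).+1 * y2 * w ^- (o + t).+1 =
    w ^+ (o + t) * (w * y2 * w^-1) * w ^- (o + t).
  by rewrite expgSr invgM !mulgA.
apply: (translates_commute (j := (o * size c + j)%N) hx (shift _ _ _ _ _ t2));
  rewrite ?mulnDl; lia.
Qed.

End Meeting.

(** * Additive functionals on free groups *)

Section Sums.
Variable I : choiceType.
Implicit Types (u v c : seq (I * bool)) (psi : I -> int).
Local Open Scope ring_scope.
Import Order.TTheory GRing.Theory Num.Theory.

Definition wsum psi u : int :=
  \sum_(l <- u) (if l.2 then - psi l.1 else psi l.1).

Lemma wsum_cat psi u v : wsum psi (u ++ v) = wsum psi u + wsum psi v.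
Proof. exact: big_cat. Qed.

Lemma wsum_equiv psi (rels : seq (word I)) u v :
    (forall r, r \in rels -> wsum psi r = 0) -> word_equiv rels u v ->
  wsum psi u = wsum psi v.
Proof.
move=> hr; elim=> {u v} [//|u v _ -> //|v u w _ -> _ -> //|u v x b|u v r rr].
  rewrite !wsum_cat /wsum !big_cons /=; congr (_ + _).
  by case: b => /=; rewrite addrA ?subrr ?addNr add0r.
by rewrite !wsum_cat (hr r) // add0r.
Qed.

(** The homomorphism to the integers with values [psi] on the generators; pairs of these detect
    independence in homology. *)
Definition lam psi (x : fg I) : int := wsum psi (repr x).

Lemma lam_fw psi u : lam psi (fw u) = wsum psi u.
Proof. by apply: wsum_equiv (repr_pi _ _). Qed.

Lemma lamM psi (x y : fg I) : lam psi (x * y)%g = lam psi x + lam psi y.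
Proof. by rewrite -[x]nfK -[y]nfK -fw_cat !lam_fw wsum_cat. Qed.

Lemma lam1 psi : lam psi 1%g = 0.
Proof. by rewrite -[1%g](fw_nil I) lam_fw /wsum big_nil. Qed.

Lemma lamV psi (x : fg I) : lam psi x^-1%g = - lam psi x.
Proof. by apply: (addrI (lam psi x)); rewrite -lamM mulgV lam1 subrr. Qed.

Lemma lamX psi (x : fg I) n : lam psi (x ^+ n)%g = lam psi x *+ n.
Proof. by elim: n => [|n IH]; rewrite ?lam1 // expgS lamM IH mulrS. Qed.

Lemma lamJ psi (x y : fg I) : lam psi (x ^ y)%g = lam psi x.
Proof. by rewrite /conjg !lamM lamV addrCA addNr addr0. Qed.

(** Makes [lam psi] bounded by word length. *)
Definition unit_bounded psi := forall i, `|psi i| <= 1.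

Lemma wsum_bound psi u : unit_bounded psi -> `|wsum psi u| <= (size u)%:Z.
Proof.
move=> bd; elim: u => [|[i b] u IH]; first by rewrite /wsum big_nil.
rewrite /wsum big_cons -/(wsum psi u) /=; apply: le_trans (ler_normD _ _) _.
have := bd i; case: b; rewrite ?normrN; lia.
Qed.

Lemma lam_ratio psi (r : fg I) i j :
  lam psi (r ^+ i * r ^- j)%g = lam psi r * (i%:Z - j%:Z).
Proof.
by rewrite lamM lamV !lamX mulrBr -[_ *+ i]mulr_natr -[_ *+ j]mulr_natr !natz.
Qed.

(** Commuting elements are powers of a common root, so their homology classes are proportional. *)
Lemma commute_lam psi mu (x y : fg I) : (x * y = y * x)%g ->
  lam psi x * lam mu y = lam psi y * lam mu x.
Proof.
move=> xy; have [->|x1] := pselect (x = 1%g); first by rewrite !lam1 mul0r mulr0.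
have [r rP] := centralizer_cyclic x1.
have [m [n ->]] := rP x erefl; have [m' [n' ->]] := rP y (esym xy).
by rewrite !lam_ratio mulrACA [RHS]mulrACA [X in _ = _ * X]mulrC.
Qed.

(** [e] is a power of a root of [x], and one of the functionals is nonzero on that root, so the
    exponent of [e] vanishes. *)
Lemma commute_lam0 psi mu (x e : fg I) : (e * x = x * e)%g -> x <> 1%g ->
    lam psi x <> 0 \/ lam mu x <> 0 -> lam psi e = 0 -> lam mu e = 0 -> e = 1%g.
Proof.
move=> ex x1 nz; have [r rP] := centralizer_cyclic x1.
have [m [n ->]] := rP e ex; have [m' [n' xE]] := rP x erefl.
rewrite !lam_ratio => e1 e2; suff -> : m = n by rewrite mulgV.
apply/eqP; rewrite -eqz_nat -subr_eq0; apply/negP => /negP mn; move: nz.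
rewrite xE !lam_ratio; move/eqP: e1; move/eqP: e2; rewrite !mulf_eq0 !(negPf mn) !orbF.
by move=> /eqP-> /eqP->; rewrite !mul0r; case.
Qed.

End Sums.

(** * Rigidity of a product of large powers *)

Section RigidPair.
Variable I : choiceType.
Implicit Types (x y w g : fg I) (psi mu : I -> int) (n : nat).
Import Order.TTheory GRing.Theory Num.Theory.

(** Modulo [n2] the factor [n1] is invertible, so [p] and [r] are congruent; the bound excludes a
    nonzero multiple of [n2] as their difference. *)
Lemma coprime_small_eq (n1 n2 : nat) (p q r s : int) : coprime n1 n2 ->
    (p *+ n1 + q *+ n2 = r *+ n1 + s *+ n2 -> `|p| + `|r| < n2%:Z -> p = r)%R.
Proof.
move=> co; rewrite -(mulr_natr p) -(mulr_natr q) -(mulr_natr r) -(mulr_natr s) !natz.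
move=> e lt.
have {}e : ((p - r) * n1%:Z = (s - q) * n2%:Z)%R by lia.
have : (n2 %| (p - r)%R)%Z.
  rewrite -(@Gauss_dvdzl _ _ n1); first by rewrite e dvdz_mull.
  by rewrite /coprimez /gcdz /= gcdnC; move: co; rewrite /coprime => /eqP->.
case/dvdzP => t tE; have [t0|t0] := eqVneq t 0%R; first by move: tE; rewrite t0; lia.
have : (`|p - r| <= `|p| + `|r|)%R := ler_normB _ _.
rewrite tE normrM; have : (1 <= `|t|)%R by lia.
nia.
Qed.

(** By [coprime_small_eq], [x1] and [y1] take the same values under both functionals. The
    determinant then rules out that [x1] commutes with [y2]; commuting with [y1], it equals [y1] by
    [commute_lam0], and uniqueness of roots gives [x2 = y2]. *)
Lemma power_equation (x1 x2 y1 y2 : fg I) n1 n2 psi mu :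
    coprime n1 n2 -> 0 < n2 ->
    (lam psi y1 * lam mu y2 <> lam psi y2 * lam mu y1)%R ->
    (`|lam psi x1| + `|lam psi y1| < n2%:Z)%R ->
    (`|lam mu x1| + `|lam mu y1| < n2%:Z)%R ->
    x1 ^+ n1 * x2 ^+ n2 = y1 ^+ n1 * y2 ^+ n2 ->
    commute x1 y1 \/ commute x1 y2 -> x1 = y1 /\ x2 = y2.
Proof.
move=> co n0 det b1 b2 e cm.
have lE ps : (`|lam ps x1| + `|lam ps y1| < n2%:Z)%R -> lam ps x1 = lam ps y1.
  apply: (coprime_small_eq co (q := lam ps x2) (s := lam ps y2)).
  by rewrite -!lamX -!lamM e.
have e1 := lE _ b1; have e2 := lE _ b2.
case: cm => cm; last by case: det; rewrite -e1 -e2; exact: commute_lam.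
suff xy : x1 = y1.
  by split=> //; apply: (fg_root_uniq n0); apply: (mulgI (x1 ^+ n1)); rewrite e xy.
have cy : commute y1 (y1^-1 * x1) by apply/commuteM; [exact: commuteV|exact: commute_sym].
suff E : y1^-1 * x1 = 1 by rewrite -[x1](mulKVg y1) E mulg1.
apply: (@commute_lam0 _ psi mu y1) => //.
- by move=> y11; apply: det; rewrite y11 !lam1 mul0r mulr0.
- apply: contrapT => /not_orP[/contrapT p0 /contrapT m0].
  by apply: det; rewrite p0 m0 mul0r mulr0.
- by rewrite lamM lamV e1 addNr.
- by rewrite lamM lamV e2 addNr.
Qed.

Lemma lam_conj psi g x : lam psi (g * x * g^-1) = lam psi x.
Proof. by rewrite -[g in g * x]invgK -mulgA lamJ. Qed.

Lemma commute_conj (G : groupType) (g x y : G) :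
  commute x y -> commute (g * x * g^-1) (g * y * g^-1).
Proof. by move=> xy; rewrite /commute !mulgA !mulgVK -!(mulgA g) xy. Qed.

Lemma conj_shift (G : groupType) (h c : G) k :
  (h * c ^- k) * c * (h * c ^- k)^-1 = h * c * h^-1.
Proof. by rewrite invgM invgK !mulgA -(mulgA _ c) -expgS expgSr !mulgA mulgVK. Qed.

Lemma conj_rotate (G : groupType) (h c b : G) k m :
  (h * c ^- k) * (c ^+ k * b * c ^+ m) * (h * c ^- k)^-1 =
  h * b * c ^+ (m + k) * h^-1.
Proof. by rewrite invgM invgK !mulgA mulgVK expgnDr !mulgA. Qed.

(* The exponents are coprime and large compared with [y1] and [y2]. *)
Theorem rigid_pair (y1 y2 : fg I) psi mu : unit_bounded psi -> unit_bounded mu ->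
    (lam psi y1 * lam mu y2 <> lam psi y2 * lam mu y1)%R ->
  exists n1 n2, [/\ 0 < n1, 0 < n2 & forall x1 x2, x1 * x2 <> x2 * x1 ->
    let w := y1 ^+ n1 * y2 ^+ n2 in x1 ^+ n1 * x2 ^+ n2 = w ->
    exists e f, x1 = y1 ^ (w ^- f * w ^+ e) /\ x2 = y2 ^ (w ^- f * w ^+ e)].
Proof.
move=> bp bm det.
have ny : y1 * y2 <> y2 * y1 by move=> h; apply: det; exact: commute_lam.
have [l1 [l2 [C [l10 l20 runs]]]] := two_runs ny.
pose L := (absz (lam psi y1) + absz (lam psi y2) + absz (lam mu y1) + absz (lam mu y2))%N.
(* Three demands fix the size of [n]: a run of about [n] copies must be long enough for [run_meets],
   it must force [size d] to be at most [l1 + l2], and [n] must exceed the values of the functionals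
   as [power_equation] requires. *)
pose n := (20 * (l1 + l2 + C) + L + 20)%N.
have nL : L + (l1 + l2) < n by rewrite /n; lia.
exists n, n.+1; split=> // [|x1 x2 nx w ew]; first by rewrite /n; lia.
have [||Q [c [m1 [k1 [m2 [k2 []]]]]]] := runs n n.+1; [rewrite /n; lia..|].
rewrite -/w => -[cc wE] [cE kC] [m1n m2n] t1 t2.
have sd r (d T z : seq (I * bool)) g x : n - 7 <= r -> cycred T -> cycred d ->
    T = z ++ wpow d r -> x = g * fw d * g^-1 -> w = g * fw T * g^-1 ->
    [/\ (`|lam psi x| <= (l1 + l2)%:Z)%R, (`|lam mu x| <= (l1 + l2)%:Z)%R &
    exists e f, commute (w ^+ e * x * w ^- e) (w ^+ f * y1 * w ^- f) \/
      commute (w ^+ e * x * w ^- e) (w ^+ f * y2 * w ^- f)].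
  move=> nr cT cd TE xE wE'; have d0 := cycred_size cd.
  have [|sT meet] := run_meets cc wE cE t1 t2 cT cd TE xE wE'.
    have h1 : n - 11 <= (r - 4) * size d by rewrite -[n - 11]muln1 leq_mul //; lia.
    have h2 : (r * size d = (r - 4) * size d + 4 * size d)%N.
      by rewrite -mulnDl subnK //; move: nr; rewrite /n; lia.
    have h3 : maxn l1 l2 <= l1 + l2 by rewrite geq_max leq_addr leq_addl.
    by rewrite h2; move: h1 h3 kC; rewrite /n; clear; lia.
  (* At least [n - 7] copies of [d] fit in one period of [w], of length at most
     [n * l1 + n.+1 * l2 + C]. *)
  have dl : size d <= l1 + l2.
    rewrite leqNgt; apply/negP => lt; have : r * size d <= size c.
      by rewrite -sT TE size_cat size_wpow leq_addl.
    have : (n - 7) * (l1 + l2).+1 <= r * size d by apply: leq_mul.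
    rewrite cE; move: m1n m2n kC; rewrite /n; clear; nia.
  have le ps : unit_bounded ps -> (`|lam ps x| <= (l1 + l2)%:Z)%R.
    move=> bps; rewrite xE lam_conj lam_fw; apply: le_trans (wsum_bound d bps) _.
    by rewrite lez_nat.
  by split=> //; exact: le.
have co : coprime n n.+1 by rewrite coprimenS.
have nx2 : x1 <> 1 by move=> h; apply: nx; rewrite h mul1g mulg1.
have nx1 : x2 <> 1 by move=> h; apply: nx; rewrite h mul1g mulg1.
have [h [a [b [ca x1E x2E br]]]] := align nx2 nx1.
have nab : fw a * b <> b * fw a.
  by move=> e; apply: nx; rewrite x1E x2E; exact: commute_conj.
have fin g : commute g w -> g * x1 * g^-1 = y1 /\ g * x2 * g^-1 = y2 ->
    x1 = y1 ^ g /\ x2 = y2 ^ g.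
  by move=> _ [<- <-]; split; rewrite /conjg !mulgA mulVg mul1g mulgVK.
have cw e f : commute (w ^- f * w ^+ e) w.
  apply/commute_sym/commuteM; [apply/commuteV/commuteX|apply/commuteX] => //.
have weq g : commute g w -> (g * x1 * g^-1) ^+ n * (g * x2 * g^-1) ^+ n.+1 = w.
  move=> gw; rewrite !conjXV !mulgA mulgVK -(mulgA g) ew gw.
  by rewrite mulgK.
have unw e f x y : commute (w ^+ e * x * w ^- e) (w ^+ f * y * w ^- f) ->
    commute (w ^- f * w ^+ e * x * (w ^- f * w ^+ e)^-1) y.
  move=> /(commute_conj (w ^- f)); rewrite !invgK !mulgA mulVg mul1g mulgVK.
  by rewrite invgM invgK !mulgA.
(* The long run belongs to the dominating element: [x1], unless both axes pass through the origin
   and [x2] has the larger translation length. *)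
have [dom|[c2 [cc2 bE s]]] : dominated a b \/
    exists c2, [/\ cycred c2, b = fw c2 & size a < size c2].
- case: br => [[c2 cc2 bE]|br]; last by left; right.
  by have [s|s] := leqP (size c2) (size a); [left; left; exists c2|right; exists c2].
- have [|T [z [cT TE fT]]] := @end_run _ a b n.+1 n ca dom nab isT; first by rewrite /n; lia.
  have [||b1 b2 [e [f cm]]] := sd (n - 7)%N a T z (h * fw a ^+ (n - 4)) x1 (leqnn _) cT ca TE.
  + by rewrite invgM !mulgA -(mulgA h) -expgSr expgS mulgA mulgK.
  + rewrite fT -ew x1E x2E !conjXV invgM !mulgA mulgVK mulgK.
    have [k nk] : exists k, n = k.+4 by exists (n - 4); rewrite /n; lia.
    by rewrite nk !subSS subn0 -(mulgA h (_ ^+ k)) -expgSr -3!(mulgA h _ (fw a)) -!expgSr.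
  exists e, f; apply: fin => //.
  apply: (@power_equation _ _ _ _ n n.+1 psi mu) => //; rewrite ?lam_conj.
  + by move: b1 nL; rewrite /L; lia.
  + by move: b2 nL; rewrite /L; lia.
  + exact: weq.
  + by case: cm => /unw; [left|right].
have nab' : fw c2 * fw a <> fw a * fw c2 by rewrite -bE => e; apply: nab.
have dom : dominated c2 (fw a) by left; exists a; split=> //; exact: ltnW.
have [||T [z [cT TE fT]]] := @end_run _ c2 (fw a) n n.+1 cc2 dom nab'; [by rewrite /n; lia..|].
have [|||b1 b2 [e [f cm]]] := sd (n.+1 - 7)%N c2 T z (h * fw c2 ^- 4) x2 _ cT cc2 TE.
- by rewrite leq_sub2r.
- by rewrite conj_shift x2E bE.
- rewrite fT conj_rotate -ew x1E x2E bE !conjXV !mulgA mulgVK subnK //; rewrite /n; lia.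
exists e, f; apply: fin => //.
(* Inverting the equation puts the power of [x2] first, the place that [power_equation] reserves for
   the element known to commute. *)
have [|||||||/invg_inj -> /invg_inj ->//] := @power_equation
   ((w ^- f * w ^+ e) * x2 * (w ^- f * w ^+ e)^-1)^-1
   ((w ^- f * w ^+ e) * x1 * (w ^- f * w ^+ e)^-1)^-1 y2^-1 y1^-1 n.+1 n psi mu.
- by rewrite coprime_sym.
- by rewrite /n; lia.
- by rewrite !lamV !mulrNN => e'; apply: det; rewrite mulrC e' mulrC.
- by rewrite !lamV !normrN lam_conj; move: b1 nL; rewrite /L; lia.
- by rewrite !lamV !normrN lam_conj; move: b2 nL; rewrite /L; lia.
- by rewrite !expVgn -!invgM weq.
- by case: cm => /unw cm; [right|left]; apply/commuteV/commute_sym/commuteV/commute_sym.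
Qed.

End RigidPair.

(** * Conjugations as automorphisms *)

Section Inner.
Variable G : groupType.

Lemma inn_automorphism (z : G) : is_automorphism (fun x : G => x ^ z).
Proof.
apply/asboolP; split; first by move=> x y; rewrite conjMg.
by exists (fun x => x ^ z^-1); [exact: conjgK|exact: conjgKV].
Qed.

Definition inn (z : G) : gaut G :=
  exist (fun f : G -> G => is_automorphism f) _ (inn_automorphism z).

End Inner.

(** * Rigid elements *)

Section Chain.
Variables (G : groupType) (I : choiceType) (C : set G) (rho : G -> fg I).
Hypothesis C1 : C 1.
Hypothesis CM : forall x y, C x -> C y -> C (x * y).
Hypothesis CV : forall x, C x -> C x^-1.
Hypothesis Caut : forall (f : gaut G) x, C x -> C (f x).
Hypothesis rhoM : forall x y, C x -> C y -> rho (x * y) = rho x * rho y.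
Hypothesis rho_eq1 : forall x, C x -> rho x = 1 -> x = 1.
Implicit Types (x y s : G) (f : gaut G) (psi mu alpha sigma : I -> int) (m n k : nat).
Import Order.TTheory GRing.Theory Num.Theory.

Lemma C_exp x n : C x -> C (x ^+ n).
Proof. by move=> Cx; elim: n => [|n IH]; rewrite ?expgS; [exact: C1|exact: CM]. Qed.

Lemma rho1 : rho 1 = 1.
Proof. by apply: (mulgI (rho 1)); rewrite -rhoM // !mulg1. Qed.

Lemma rhoV x : C x -> rho x^-1 = (rho x)^-1.
Proof.
by move=> Cx; apply: (mulgI (rho x)); rewrite -rhoM ?mulgV ?rho1 //; exact: CV.
Qed.

Lemma rhoX x n : C x -> rho (x ^+ n) = rho x ^+ n.
Proof.
move=> Cx; elim: n => [|n IH]; first exact: rho1.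
by rewrite !expgS rhoM ?IH //; exact: C_exp.
Qed.

Lemma rho_inj x y : C x -> C y -> rho x = rho y -> x = y.
Proof.
move=> Cx Cy e; apply: (mulIg y^-1); rewrite mulgV; apply: rho_eq1.
  by apply: CM => //; exact: CV.
by rewrite rhoM ?rhoV ?e ?mulgV //; exact: CV.
Qed.

Local Notation Lam psi x := (lam psi (rho x)).

Lemma LamM psi x y : C x -> C y -> Lam psi (x * y) = (Lam psi x + Lam psi y)%R.
Proof. by move=> Cx Cy; rewrite rhoM // lamM. Qed.

Lemma LamX psi x n : C x -> Lam psi (x ^+ n) = (Lam psi x *+ n)%R.
Proof. by move=> Cx; rewrite rhoX // lamX. Qed.

(** An integral power of [x], the exponent being the difference of two naturals. *)
Definition ratio x (e e' : nat) : G := x ^- e' * x ^+ e.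

Lemma C_ratio x e e' : C x -> C (ratio x e e').
Proof. by move=> Cx; apply: CM; [apply: CV|]; exact: C_exp. Qed.

Lemma Lam_ratio psi x e e' : C x ->
  Lam psi (ratio x e e') = (Lam psi x * (e%:Z - e'%:Z))%R.
Proof.
move=> Cx; rewrite LamM; [|by apply/CV/C_exp|exact: C_exp].
rewrite rhoV ?lamV; last exact: C_exp.
by rewrite !LamX // mulrBr addrC -[(_ *+ e)%R]mulr_natr -[(_ *+ e')%R]mulr_natr !natz.
Qed.

Lemma ratio_eq1 x e e' : (e%:Z - e'%:Z = 0 :> int)%R -> ratio x e e' = 1.
Proof.
move=> h; have -> : e' = e by lia.
by rewrite /ratio mulVg.
Qed.

(** One power of [X] conjugates both [y1] and [y2]; having it in common allows it to be undone by a
    single inner automorphism. *)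
Definition rigid_root y1 y2 X := [/\ C X,
  exists n1 n2, [/\ 0 < n1, 0 < n2 & X = y1 ^+ n1 * y2 ^+ n2] &
  forall f, f X = X -> exists e e',
    f y1 = y1 ^ ratio X e e' /\ f y2 = y2 ^ ratio X e e'].

(** [rigid_pair] is applied to the images under [rho] of [f y1] and [f y2], which stay in [C]; [f]
    need not induce an automorphism of the free group. *)
Lemma rigid_root_exists y1 y2 psi mu : C y1 -> C y2 ->
    unit_bounded psi -> unit_bounded mu ->
    (Lam psi y1 * Lam mu y2 <> Lam psi y2 * Lam mu y1)%R ->
  exists X, rigid_root y1 y2 X.
Proof.
move=> C1' C2 bp bm det; have [n1 [n2 [n10 n20 rp]]] := rigid_pair bp bm det.
have CX : C (y1 ^+ n1 * y2 ^+ n2) by apply: CM; exact: C_exp.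
have [X XE] : exists X, X = y1 ^+ n1 * y2 ^+ n2 by eexists.
rewrite -XE in CX; exists X; split=> //; first by exists n1, n2.
move=> f fX; have [fM fB] := gautP f.
have Cf := Caut f; have Cf1 := Cf _ C1'; have Cf2 := Cf _ C2.
have rXE : rho X = rho y1 ^+ n1 * rho y2 ^+ n2.
  by rewrite XE rhoM ?rhoX //; exact: C_exp.
have [||e [e' [e1 e2]]] := rp (rho (f y1)) (rho (f y2)).
- move=> e; apply: det; apply: commute_lam.
  have {}e : f y1 * f y2 = f y2 * f y1 by apply: rho_inj; rewrite ?rhoM //; exact: CM.
  by rewrite -!rhoM //; congr rho; apply: (bij_inj fB); rewrite !fM.
- rewrite -!rhoX // -!rhoM; [|exact: C_exp..].
  by rewrite -!(morphX_of fM) -fM -XE fX.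
exists e, e'; have Cr := C_ratio e e' CX.
have CJ y : C y -> rho (y ^ ratio X e e') = rho y ^ (rho X ^- e' * rho X ^+ e).
  move=> Cy; have Crr := CV Cr; have Cyr := CM Cy Cr; rewrite /conjg.
  have Ce := C_exp e CX; have Ce' := C_exp e' CX; have CVe := CV Ce'.
  by rewrite /ratio in Cr Crr Cyr *; rewrite !rhoM ?rhoV ?rhoM ?rhoV ?rhoX.
have CrJ y : C y -> C (y ^ ratio X e e').
  by move=> Cy; rewrite /conjg; apply: CM; [exact: CV|exact: CM].
by split; apply: rho_inj => //; try exact: CrJ; rewrite CJ // rXE.
Qed.

Lemma Lam_root y1 y2 X : C y1 -> C y2 -> rigid_root y1 y2 X ->
  exists p q : int, [/\ p <> 0, q <> 0 & forall psi,
    Lam psi X = p * Lam psi y1 + q * Lam psi y2]%R.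
Proof.
move=> C1' C2 [CX [n1 [n2 [n10 n20 ->]]] _]; exists (n1%:Z)%R, (n2%:Z)%R.
split=> [||ps]; [lia..|].
rewrite LamM ?LamX //; [|exact: C_exp..].
by rewrite -(mulr_natl (Lam ps y1)) -(mulr_natl (Lam ps y2)) !natz.
Qed.

Lemma commute_Lam psi mu x y : C x -> C y -> commute x y ->
  (Lam psi x * Lam mu y = Lam psi y * Lam mu x)%R.
Proof. by move=> Cx Cy xy; apply: commute_lam; rewrite -!rhoM // xy. Qed.

Variables (s : G) (alpha sigma : I -> int).
Hypothesis Cs : C s.
Hypotheses (ab : unit_bounded alpha) (sb : unit_bounded sigma).
Hypotheses (alpha_s : Lam alpha s = 0%R) (sigma_s : Lam sigma s <> 0%R).

Lemma Lam_commute_s psi x : C x -> commute x s -> Lam psi s = 0%R -> Lam psi x = 0%R.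
Proof.
move=> Cx xs ps; have := commute_Lam psi sigma Cx Cs xs.
by rewrite ps mul0r => /eqP; rewrite mulf_eq0 (introF eqP sigma_s) orbF => /eqP.
Qed.

(** [A] is a rigid root of [x] and [s], and [Y] one of [A] and [b]. An automorphism fixing [Y] gives
    a power of [Y], then a power of [A], as conjugators; because it also fixes [s], both powers turn
    out trivial. *)
Lemma chain_step x b beta : C x -> C b -> unit_bounded beta ->
    (Lam beta s = 0 -> Lam beta x = 0 -> Lam alpha b = 0 ->
     Lam beta b <> 0 -> Lam alpha x <> 0 ->
  exists Y, [/\ C Y, exists p q r : int, p <> 0 /\ (forall psi,
      Lam psi Y = p * Lam psi x + q * Lam psi s + r * Lam psi b) &
    forall f, f s = s -> f Y = Y -> f x = x /\ f b = b])%R.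
Proof.
move=> Cx Cb bb bs bx alb bnz anz.
have [|A rA] := rigid_root_exists Cx Cs ab sb.
  by rewrite alpha_s mul0r => /eqP; rewrite mulf_eq0; case/orP => /eqP.
have [p [q [p0 q0 LA]]] := Lam_root Cx Cs rA; have [CA _ fA] := rA.
have aA : Lam alpha A <> 0%R.
  by rewrite LA alpha_s mulr0 addr0 => /eqP; rewrite mulf_eq0; case/orP => /eqP.
have bA : Lam beta A = 0%R by rewrite LA bs bx !mulr0 addr0.
have [|Y rY] := rigid_root_exists CA Cb ab bb.
  by rewrite alb mul0r => /eqP; rewrite mulf_eq0; case/orP => /eqP.
have [p' [q' [p'0 q'0 LY]]] := Lam_root CA Cb rY; have [CY _ fY] := rY.
have bY : Lam beta Y <> 0%R.
  by rewrite LY bA mulr0 add0r => /eqP; rewrite mulf_eq0; case/orP => /eqP.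
exists Y; split=> //.
  exists (p' * p)%R, (p' * q)%R, q'; split.
    by move/eqP; rewrite mulf_eq0; case/orP => /eqP.
  by move=> psi; rewrite LY LA mulrDr !mulrA.
move=> f fs /fY[e [e' [eA eb]]]; have CgY := C_ratio e e' CY.
pose f' : gaut G := inn (ratio Y e e')^-1 * f.
have f'E y : f' y = f y ^ (ratio Y e e')^-1 by [].
have [|k [k' [ex es]]] := fA f'; first by rewrite f'E eA conjgK.
have CgA := C_ratio k k' CA.
(* The product of the two conjugators commutes with [s], so every functional vanishing on [s] kills
   it: [beta] removes the power of [Y], then [alpha] that of [A]. *)
have cm : commute (ratio A k k' * ratio Y e e') s.
  have sE : s ^ (ratio A k k' * ratio Y e e') = s by rewrite conjgM -es f'E fs conjgKV.
  by rewrite /commute -{1}sE -conjgC.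
have L0 psi := @Lam_commute_s psi _ (CM CgA CgY) cm.
have LE psi : Lam psi (ratio A k k' * ratio Y e e') =
   (Lam psi A * (k%:Z - k'%:Z) + Lam psi Y * (e%:Z - e'%:Z))%R.
  by rewrite LamM // !Lam_ratio.
have e0 : (e%:Z - e'%:Z = 0)%R.
  have := L0 beta bs; rewrite LE bA mul0r add0r => /eqP; rewrite mulf_eq0.
  by case/orP => /eqP.
have k0 : (k%:Z - k'%:Z = 0)%R.
  have := L0 alpha alpha_s; rewrite LE e0 mulr0 addr0 => /eqP; rewrite mulf_eq0.
  by case/orP => /eqP.
move: eb ex; rewrite f'E !(ratio_eq1 _ e0) !(ratio_eq1 _ k0) invg1 !conjg1.
by move=> -> ->.
Qed.

(** The [B i] are absorbed one at a time by [chain_step]. The functionals form a triangular system: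
    [beta i] vanishes on everything absorbed before [B i]. A last rigid root, with [s], removes the
    assumption that [s] is fixed. *)
Lemma chain_exists (X0 : G) (B : nat -> G) (beta : nat -> I -> int) m :
    C X0 -> (forall i, C (B i)) -> (forall i, unit_bounded (beta i)) ->
    (Lam alpha X0 <> 0)%R -> (forall i, Lam alpha (B i) = 0%R) ->
    (forall i, Lam (beta i) s = 0%R) -> (forall i, Lam (beta i) X0 = 0%R) ->
    (forall i, Lam (beta i) (B i) <> 0%R) ->
    (forall i j, j < i -> Lam (beta i) (B j) = 0%R) ->
  exists Z, forall f u, f Z = Z ^ u -> exists v,
    [/\ f s = s ^ v, f X0 = X0 ^ v & forall j, j < m -> f (B j) = B j ^ v].
Proof.
move=> CX0 CB bb aX aB bs bX bB bB0.
have [X [CX aX' _ hX]] : exists X, [/\ C X, (Lam alpha X <> 0)%R,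
    forall i, m <= i -> Lam (beta i) X = 0%R & forall f, f s = s -> f X = X ->
      f X0 = X0 /\ forall j, j < m -> f (B j) = B j].
  elim: m => [|m [X [CX aX' bX' hX]]]; first by exists X0.
  have [Y [CY [p [q [r [p0 LY]]]] hY]] :=
    chain_step CX (CB m) (bb m) (bs m) (bX' m (leqnn m)) (aB m) (bB m) aX'.
  exists Y; split=> //.
  - rewrite LY alpha_s aB !mulr0 !addr0 => /eqP; rewrite mulf_eq0.
    by case/orP => /eqP.
  - by move=> i mi; rewrite LY bX' ?bs ?bB0 ?mulr0 ?addr0 //; exact: ltnW.
  - move=> f fs fY; have [fX fB] := hY f fs fY; have [fX0 fBj] := hX f fs fX.
    by split=> // j; rewrite ltnS leq_eqVlt => /orP[/eqP->|/fBj].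
have [|Z [CZ _ fZ]] := rigid_root_exists CX Cs ab sb.
  by rewrite alpha_s mul0r => /eqP; rewrite mulf_eq0; case/orP => /eqP.
exists Z => f u fu; pose f1 : gaut G := inn u^-1 * f.
have f1E y : f1 y = f y ^ u^-1 by [].
have [|e [e' [eX es]]] := fZ f1; first by rewrite f1E fu conjgK.
(* [f1] fixes [Z]; undoing the power of [Z] as well makes [f2] fix both [s] and [X]. *)
pose f2 : gaut G := inn (ratio Z e e')^-1 * f1.
have f2E y : f2 y = f y ^ (u^-1 * (ratio Z e e')^-1) by rewrite conjgM.
have [||g1 g2] := hX f2.
- by rewrite /f2 [LHS](_ : _ = f1 s ^ (ratio Z e e')^-1) // es conjgK.
- by rewrite /f2 [LHS](_ : _ = f1 X ^ (ratio Z e e')^-1) // eX conjgK.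
have back y : f2 y = y -> f y = y ^ (ratio Z e e' * u).
  by rewrite f2E => {2}<-; rewrite -invMg conjgKV.
exists (ratio Z e e' * u); split; [|exact: back|by move=> j /g2 /back].
apply: back; by rewrite /f2 [LHS](_ : _ = f1 s ^ (ratio Z e e')^-1) // es conjgK.
Qed.

End Chain.

(** * Powers with integral exponents *)

Section IntegerPowers.
Variables (G : groupType) (x : G).

Definition zexp (k : int) : G :=
  match k with Posz i => x ^+ i | Negz i => x ^- i.+1 end.

Lemma zexpS k : zexp (k + 1)%R = zexp k * x.
Proof.
case: k => [i|[|i]]; first by rewrite -PoszD addn1 /= expgSr.
  by rewrite (_ : Negz 0 + 1 = 0)%R // /= expg1 mulVg.
rewrite (_ : Negz i.+1 + 1 = Negz i)%R ?NegzE; last by lia.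
by rewrite /= [in RHS]expgS invMg mulgVK.
Qed.

Lemma zexpB k : zexp (k - 1)%R = zexp k * x^-1.
Proof. by rewrite -{2}(GRing.subrK 1%R k) zexpS mulgK. Qed.

End IntegerPowers.

(** * The infinite cyclic cover of the surface *)

Section Surface.
Variable n : nat.
Local Notation g := n.+2.
Local Notation S := (sgen g).
Local Notation surf := (presented [:: surface_relator g]).
Local Notation I := (int * S)%type.
Import Order.TTheory GRing.Theory Num.Theory.
Local Open Scope ring_scope.
Local Open Scope group_scope.
Implicit Types (x y z : surf) (s : S) (u v w : seq (S * bool)) (k m : int) (i j : nat).

Definition tgen : S := inl ord0.
Definition bgen : S := inr ord0.

(** The product of the commutators of all handles but the first. *)
Definition rest : seq (S * bool) :=
  flatten [seq [:: (inl i : S, false); (inr i : S, false);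
                   (inl i : S, true); (inr i : S, true)]
          | i : 'I_g <- [seq lift ord0 j | j : 'I_n.+1 <- enum 'I_n.+1]].

Lemma surface_relatorE : surface_relator g =
  [:: (tgen, false); (bgen, false); (tgen, true); (bgen, true)] ++ rest.
Proof. by rewrite /surface_relator enum_ordSl. Qed.

Lemma rest_letters l : l \in rest -> (l.1 != tgen) && (l.1 != bgen).
Proof.
case/flatten_mapP => i /mapP[j _ ->].
by rewrite !inE => /orP[/eqP->|/orP[/eqP->|/orP[/eqP->|/eqP->]]].
Qed.

Definition gen s : surf := pw _ [:: (s, false)].
Local Notation T := (gen tgen).
Local Notation tpow := (zexp T).

Lemma genV s : pw _ [:: (s, true)] = (gen s)^-1.
Proof. by rewrite /gen -pw_inv. Qed.

Definition texp s : int := if s == tgen then 1%R else 0%R.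
Local Notation chiw := (wsum texp).

Definition lett k s : fg I := fw [:: ((k, s), false)].

Definition shifted k w : seq (I * bool) := [seq ((k, l.1), l.2) | l <- w].

(** Stands for t^k [rest] t^-k. *)
Definition commprod k : fg I := fw (shifted k rest).

(* [lett k s] stands for [t^k s t^-k] when [s] is neither [t] nor [b], and
   [lett 0 b] stands for [b]; in terms of these, [bconj k] is [t^k b t^-k], since
   the relator says that [t b t^-1] is the inverse of [rest] times [b]. *)
Fixpoint bpos i : fg I :=
  if i is i'.+1 then (commprod i'%:Z%R)^-1 * bpos i' else lett 0%R bgen.
Fixpoint bneg i : fg I :=
  if i is i'.+1 then commprod (- i'.+1%:Z)%R * bneg i' else lett 0%R bgen.
Definition bconj k : fg I := match k with Posz i => bpos i | Negz i => bneg i.+1 end.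

Lemma bconjS k : bconj (k + 1)%R = (commprod k)^-1 * bconj k.
Proof.
case: k => [i|[|i]]; first by rewrite -PoszD addn1.
  by rewrite (_ : Negz 0 + 1 = 0)%R // /= mulKg.
by rewrite (_ : Negz i.+1 + 1 = Negz i)%R ?NegzE; [rewrite /= mulKg|lia].
Qed.

(* The value of a letter [s] read after a prefix of [t]-exponent [k]. *)
Definition rsval k s : fg I :=
  if s == tgen then 1 else if s == bgen then bconj k else lett k s.

Definition tstep (l : S * bool) : int := (if l.2 then - texp l.1 else texp l.1)%R.

(** Reidemeister-Schreier rewriting of [w], read from the coset of t^k. *)
Fixpoint rs k w : fg I :=
  if w is l :: w' then letter_val (rsval k) l * rs (k + tstep l)%R w' else 1.

Lemma chiw_cons l w : chiw (l :: w) = (tstep l + chiw w)%R.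
Proof. by rewrite /wsum big_cons. Qed.

Lemma rs_cat k u v : rs k (u ++ v) = rs k u * rs (k + chiw u)%R v.
Proof.
elim: u k => [|l u IH] k /=; first by rewrite mul1g /wsum big_nil addr0.
by rewrite IH chiw_cons mulgA addrA.
Qed.

Lemma fw_cons1 (J : choiceType) (l : J * bool) (w : seq (J * bool)) :
  fw (l :: w) = fw [:: l] * fw w.
Proof. by rewrite -fw_cat. Qed.

Lemma rs_shifted k w : {in w, forall l, (l.1 != tgen) && (l.1 != bgen)} ->
  rs k w = fw (shifted k w) /\ chiw w = 0%R.
Proof.
elim: w k => [|[s b] w IH] k h; first by rewrite /wsum big_nil.
have /= /andP[/negPf st /negPf sb] := h (s, b) (mem_head _ _).
have t0 : tstep (s, b) = 0%R by rewrite /tstep /texp /= st; case: b {h}; rewrite ?oppr0.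
have [|_ e] := IH k; first by move=> l lw; apply: h; rewrite inE lw orbT.
rewrite chiw_cons t0 e add0r; split=> //.
rewrite /= addr0 [RHS]fw_cons1; congr (_ * _).
  rewrite /letter_val /rsval /= st sb /lett; case: b {h t0} => //.
  by rewrite -fw_inv.
by have [|-> _] := IH k; first by move=> l lw; apply: h; rewrite inE lw orbT.
Qed.

(** At level [k] the relator is rewritten as [bconj (k + 1) * (bconj k)^-1 * commprod k], trivial by
    the recursion that defines [bconj]. *)
Lemma rs_relator k : rs k (surface_relator g) = 1 /\ chiw (surface_relator g) = 0%R.
Proof.
have h l : l \in rest -> (l.1 != tgen) && (l.1 != bgen) := @rest_letters l.
rewrite surface_relatorE rs_cat wsum_cat.
have -> : chiw [:: (tgen, false); (bgen, false); (tgen, true); (bgen, true)] = 0%R.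
  by rewrite !chiw_cons /wsum big_nil.
have [-> ->] := rs_shifted (k + 0)%R h; split=> //.
rewrite /= /letter_val /rsval /= /tstep /texp /= !addr0 addrK !mul1g mulg1.
by rewrite bconjS invg1 mul1g mulgK mulVg.
Qed.

Lemma rs_equiv k u v : word_equiv [:: surface_relator g] u v ->
  rs k u = rs k v /\ chiw u = chiw v.
Proof.
move=> e; split; last first.
  by apply: wsum_equiv e => r; rewrite inE => /eqP->; have [] := rs_relator 0%R.
elim: e k => {u v} [//|u v _ IH k|v u w _ IH1 _ IH2 k|u v s b k|u v r rr k].
- by rewrite IH.
- by rewrite IH1.
- rewrite !rs_cat /=; congr (_ * _); set k' := (_ + _)%R.
  have -> : (k' + tstep (s, b) + tstep (s, ~~ b) = k')%R.
    by rewrite /tstep /=; case: b; rewrite /= ?subrK ?addrK.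
  rewrite mulgA; suff -> : letter_val (rsval k') (s, b) *
     letter_val (rsval (k' + tstep (s, b))%R) (s, ~~ b) = 1 by rewrite mul1g.
  rewrite /letter_val /rsval /tstep /texp /=; case: (s == tgen).
    by case: b; rewrite /= ?invg1 mulg1.
  by case: b => /=; rewrite ?oppr0 addr0 ?mulVg ?mulgV.
- move: rr; rewrite inE => /eqP->; rewrite !rs_cat; have [-> ->] := rs_relator (k + chiw u)%R.
  by rewrite mul1g addr0.
Qed.

Definition rsg k x : fg I := rs k (repr x).
Definition chi x : int := chiw (repr x).

Lemma rsg_pw k w : rsg k (pw _ w) = rs k w.
Proof. by have [] := rs_equiv k (repr_pi [:: surface_relator g] w). Qed.

Lemma chi_pw w : chi (pw _ w) = chiw w.
Proof. by have [] := rs_equiv 0%R (repr_pi [:: surface_relator g] w). Qed.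

Lemma rsgM k x y : rsg k (x * y) = rsg k x * rsg (k + chi x)%R y.
Proof. by rewrite -[x]pw_repr -[y]pw_repr -pw_cat !rsg_pw chi_pw rs_cat. Qed.

Lemma chiM x y : chi (x * y) = (chi x + chi y)%R.
Proof. by rewrite -[x]pw_repr -[y]pw_repr -pw_cat !chi_pw wsum_cat. Qed.

(** Gives the map back from the free group to the surface group. *)
Definition iota_letter (p : I) : surf := tpow p.1 * gen p.2 * (tpow p.1)^-1.
Definition iota (a : fg I) : surf := eval iota_letter (repr a).

Lemma iota_fw (u : seq (I * bool)) : iota (fw u) = eval iota_letter u.
Proof. exact: eval_equiv (repr_pi _ u). Qed.

Lemma iotaM : {morph iota : a b / a * b}.
Proof. by move=> a b; rewrite -[a]nfK -[b]nfK -fw_cat !iota_fw eval_cat. Qed.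

Lemma iota_shifted k w : iota (fw (shifted k w)) = tpow k * pw _ w * (tpow k)^-1.
Proof.
rewrite iota_fw; elim: w => [|[s b] w IH] /=; first by rewrite pw_nil mulg1 mulgV.
rewrite IH pw_cons /letter_val /iota_letter /=; case: b.
  by rewrite genV !invMg invgK !mulgA mulgVK.
by rewrite !mulgA mulgVK.
Qed.

Lemma int_shift_ind (P : int -> Prop) :
  P 0%R -> (forall k, P k <-> P (k + 1)%R) -> forall k, P k.
Proof.
move=> P0 PS; elim=> [//|i /PS|i]; first by rewrite -PoszD addn1.
by rewrite (_ : - i%:Z = - i.+1%:Z + 1)%R; [exact: (PS _).2|lia].
Qed.

Lemma iota_commprod k :
  iota (commprod k) = tpow k * (gen bgen * T * (gen bgen)^-1 * T^-1) * (tpow k)^-1.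
Proof.
rewrite iota_shifted; congr (_ * _ * _).
have : pw [:: surface_relator g]
    ([:: (tgen, false); (bgen, false); (tgen, true); (bgen, true)] ++ rest) = 1.
  by rewrite -surface_relatorE; exact: pw_relator (mem_head _ _).
rewrite pw_cat => /(canRL (mulKg _)) ->.
by rewrite mulg1 !(pw_cons _ _ (_ :: _)) !genV !invMg !invgK.
Qed.

Lemma iota_bconj k : iota (bconj k) = tpow k * gen bgen * (tpow k)^-1.
Proof.
elim/int_shift_ind: k => [|k].
  by rewrite /= iota_fw /= /letter_val /iota_letter /= mulg1.
rewrite bconjS iotaM (morphV_of iotaM) iota_commprod zexpS.
split=> [->|]; first by rewrite !invMg !invgK !mulgA !mulgVK.
move=> /(canRL (mulKg _)) ->.
by rewrite !invMg !invgK !mulgA !mulgVK mulgK.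
Qed.

Lemma iota_rsval k s : iota (rsval k s) * tpow (k + texp s)%R = tpow k * gen s.
Proof.
rewrite /rsval /texp; case: eqP => [->|_].
  by rewrite (morph1_of iotaM) mul1g zexpS.
case: eqP => [->|_]; first by rewrite addr0 iota_bconj mulgVK.
by rewrite addr0 iota_fw /= /letter_val /iota_letter /= mulg1 mulgVK.
Qed.

(** [iota] undoes the rewriting up to powers of t; on the kernel of [chi] this makes [rsg 0]
    injective. *)
Lemma iota_rs k w : tpow k * pw _ w = iota (rs k w) * tpow (k + chiw w)%R.
Proof.
elim: w k => [|[s b] w IH] k.
  by rewrite pw_nil mulg1 (morph1_of iotaM) mul1g /wsum big_nil addr0.
rewrite pw_cons /= iotaM chiw_cons addrA -mulgA -IH !mulgA; congr (_ * _).
rewrite /letter_val /tstep /=; case: b; last by rewrite iota_rsval.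
rewrite genV.
have := iota_rsval (k - texp s)%R s; rewrite subrK (morphV_of iotaM).
have -> : rsval (k - texp s)%R s = rsval k s.
  by rewrite /rsval /texp; case: eqP => // _; rewrite subr0.
by move=> e; apply: (mulgI (iota (rsval k s))); rewrite mulgA e mulgK mulVKg.
Qed.

Lemma rsg_eq1 x : chi x = 0%R -> rsg 0%R x = 1 -> x = 1.
Proof.
move=> c0 r0; have := iota_rs 0%R (repr x).
by rewrite -/(chi x) -/(rsg 0%R x) c0 r0 pw_repr (morph1_of iotaM) !mul1g.
Qed.

End Surface.

(** * An element of the surface group that determines automorphisms up to conjugation *)

Lemma conj_eq_commute (G : groupType) (c y z : G) :
  c ^ y = c ^ z -> commute (y * z^-1) c.
Proof. by move=> e; rewrite /commute [RHS]conjgC conjgM e conjgK. Qed.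

Section Rigid.
Variable n : nat.
Local Notation g := n.+2.
Local Notation S := (sgen g).
Local Notation surf := (presented [:: surface_relator g]).
Local Notation I := (int * S)%type.
Local Notation tgen := (tgen n).
Local Notation bgen := (bgen n).
Local Notation T := (gen tgen).
Import Order.TTheory GRing.Theory Num.Theory.
Local Open Scope ring_scope.
Local Open Scope group_scope.
Implicit Types (x y z : surf) (s : S) (k m : int) (i j : nat).

Lemma chi1 : chi (1 : surf) = 0%R.
Proof. by apply: (addrI (chi (1 : surf))); rewrite -chiM mulg1 addr0. Qed.

Lemma chiV x : chi x^-1 = (- chi x)%R.
Proof. by apply: (addrI (chi x)); rewrite -chiM mulgV chi1 subrr. Qed.

Lemma rsg1 k : rsg k (1 : surf) = 1.
Proof. by apply: (mulgI (rsg k 1)); rewrite -{2}[k]addr0 -chi1 -rsgM !mulg1. Qed.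

Lemma rsgV k x : rsg k x^-1 = (rsg (k - chi x)%R x)^-1.
Proof.
by apply: (mulIg (rsg (k - chi x)%R x)); rewrite mulVg -chiV -rsgM mulVg rsg1.
Qed.

Lemma chi_gen s : chi (gen s) = texp s.
Proof. by rewrite chi_pw chiw_cons /wsum big_nil addr0. Qed.

Lemma rsg_gen k s : rsg k (gen s) = rsval k s.
Proof. by rewrite rsg_pw /= mulg1. Qed.

Lemma texp_tgen : texp tgen = 1%R. Proof. by []. Qed.

Lemma chi_powT j : chi (T ^+ j) = j%:Z%R.
Proof.
by elim: j => [|j IH]; rewrite ?chi1 // expgSr chiM IH chi_gen texp_tgen -PoszD addn1.
Qed.

Lemma rsg_powT k j : rsg k (T ^+ j) = 1.
Proof.
elim: j k => [|j IH] k; first exact: rsg1.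
by rewrite expgS rsgM IH rsg_gen mulg1.
Qed.

(** The conjugate by t^j of the commutator of t and [s]; a commutator has zero image under every
    homomorphism to the integers. *)
Definition celt j s : surf := T ^+ j * (T * gen s * T^-1 * (gen s)^-1) * T ^- j.

Lemma celtS j s : celt j.+1 s = T * celt j s * T^-1.
Proof. by rewrite /celt [in LHS]expgS invMg !mulgA. Qed.

Definition a1 : S := inl (lift ord0 ord0).
Definition b1 : S := inr (lift ord0 ord0).
Definition ab1 (b : bool) : S := if b then b1 else a1.

Lemma ab1_inj b b' : (ab1 b == ab1 b') = (b == b').
Proof. by case: b b' => [] []. Qed.

Lemma ab1_tgen b : (ab1 b == tgen) = false. Proof. by case: b. Qed.
Lemma ab1_bgen b : (ab1 b == bgen) = false. Proof. by case: b. Qed.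

Lemma chi_celt j s : chi (celt j s) = 0%R.
Proof. by rewrite /celt !chiM !chiV; lia. Qed.

Lemma rsg_celt k j b : rsg k (celt j (ab1 b)) =
  lett (k + j%:Z + 1)%R (ab1 b) * (lett (k + j%:Z)%R (ab1 b))^-1.
Proof.
have t0 : texp (ab1 b) = 0%R by rewrite /texp ab1_tgen.
rewrite /celt !rsgM !rsgV !rsg_powT mul1g invg1 mulg1 !rsg_gen !chiM !chiV !chi_gen.
have vt m : rsval m tgen = 1 by rewrite /rsval eqxx.
rewrite !vt invg1 mul1g mulg1 texp_tgen t0 chi_powT oppr0 !addr0.
by rewrite /rsval ab1_tgen ab1_bgen.
Qed.

(** Counts the letters [s] at levels above [k]. The rewriting of [celt j s] has opposite letters at
    two consecutive levels, so the count is nonzero for a single [j]. *)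
Definition psi k s (p : I) : int := if (p.2 == s) && (k < p.1)%R then 1%R else 0%R.

Lemma psi_bounded k s : unit_bounded (psi k s).
Proof. by move=> p; rewrite /psi; case: ifP; rewrite ?normr0 ?normr1. Qed.

Lemma lam_celt k b m j b' : lam (psi k (ab1 b)) (rsg m (celt j (ab1 b'))) =
  (if (b == b') && (m + j%:Z == k)%R then 1%R else 0%R).
Proof.
rewrite rsg_celt lamM lamV !lam_fw /wsum !big_seq1 /= /psi /= ab1_inj.
rewrite eq_sym; case: (b == b') => //=.
case: eqP => e; case: ltP => h1; case: ltP => h2 //; lia.
Qed.

(** Commutation with [z] shifts levels by [chi z], which the functionals detect, so [chi z = 0]. In
    the free group a nontrivial [z] would then make two elements independent in homology commute. *)
Lemma celt_commute j z : (forall b, commute z (celt j (ab1 b))) -> z = 1.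
Proof.
move=> cz; have e b : rsg 0%R z * rsg (chi z) (celt j (ab1 b)) =
    rsg 0%R (celt j (ab1 b)) * rsg 0%R z.
  by have := congr1 (rsg 0%R) (cz b); rewrite !rsgM chi_celt !add0r.
have z0 : chi z = 0%R.
  have := congr1 (lam (psi j%:Z%R (ab1 true))) (e true).
  rewrite !lamM !lam_celt add0r !eqxx /= addrC => /addIr.
  by case: ifP => // /eqP; lia.
apply: rsg_eq1 => //; apply: contrapT => r1.
have c b : rsg 0%R (celt j (ab1 b)) * rsg 0%R z = rsg 0%R z * rsg 0%R (celt j (ab1 b)).
  by rewrite -e z0.
have := centralizer_abelian r1 (c true) (c false).
move=> /(@commute_lam _ (psi j%:Z%R (ab1 true)) (psi j%:Z%R (ab1 false))).
by rewrite !lam_celt !add0r !eqxx.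
Qed.

Lemma surf_centerless z : (forall x, commute z x) -> z = 1.
Proof. by move=> cz; apply: (@celt_commute 0). Qed.

(* Contained in the kernel of [chi] and, unlike that kernel, invariant under all
   automorphisms. *)
Definition hom_kernel : set surf :=
  [set y | forall phi : surf -> int,
    {morph phi : x z / x * z >-> (x + z)%R} -> phi y = 0%R].

Lemma hom_kernelM x y : hom_kernel x -> hom_kernel y -> hom_kernel (x * y).
Proof. by move=> hx hy phi h; rewrite h hx // hy // addr0. Qed.

Lemma additive1 (phi : surf -> int) :
  {morph phi : x z / x * z >-> (x + z)%R} -> phi 1 = 0%R.
Proof. by move=> h; apply: (addrI (phi 1)); rewrite -h mulg1 addr0. Qed.

Lemma additiveV (phi : surf -> int) x :
  {morph phi : x z / x * z >-> (x + z)%R} -> phi x^-1 = (- phi x)%R.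
Proof.
by move=> h; apply: (addrI (phi x)); rewrite -h mulgV subrr (additive1 h).
Qed.

Lemma hom_kernel1 : hom_kernel 1.
Proof. by move=> phi; exact: additive1. Qed.

Lemma hom_kernelV x : hom_kernel x -> hom_kernel x^-1.
Proof. by move=> hx phi h; rewrite additiveV // hx // oppr0. Qed.

Lemma hom_kernel_aut (f : gaut surf) x : hom_kernel x -> hom_kernel (f x).
Proof.
by move=> hx phi h; apply: (hx (phi \o f)) => u v; rewrite /= (gautP f).1 h.
Qed.

Lemma hom_kernel_chi x : hom_kernel x -> chi x = 0%R.
Proof. by apply; exact: chiM. Qed.

Lemma hom_kernelJ x y : hom_kernel x -> hom_kernel (x ^ y).
Proof.
by move=> hx phi h; rewrite /conjg !h (additiveV _ h) hx // add0r addNr.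
Qed.

Lemma celt_kernel j s : hom_kernel (celt j s).
Proof. by move=> phi h; rewrite /celt !h !(additiveV _ h); lia. Qed.

Lemma rsg0M x y : hom_kernel x -> hom_kernel y ->
  rsg 0%R (x * y) = rsg 0%R x * rsg 0%R y.
Proof. by move=> hx hy; rewrite rsgM (hom_kernel_chi hx). Qed.

Lemma rsg0J x y : chi x = 0%R -> chi y = 0%R ->
  rsg 0%R (x ^ y) = rsg 0%R x ^ rsg 0%R y.
Proof. by move=> x0 y0; rewrite /conjg !rsgM rsgV chiV x0 y0 oppr0 !addr0. Qed.

Lemma lam_conj_celt k b j b' y : chi y = 0%R ->
  lam (psi k (ab1 b)) (rsg 0%R (celt j (ab1 b') ^ y)) =
  (if (b == b') && (j%:Z == k)%R then 1%R else 0%R).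
Proof.
by move=> y0; rewrite rsg0J // ?chi_celt // lamJ lam_celt add0r.
Qed.

Definition gens : seq surf := [seq gen s | s <- enum {: 'I_g + 'I_g} & s != tgen].

(* [1] comes first, so that [celt 1] itself occurs among the conjugates. *)
Definition conjugator i : surf := nth 1 (1 :: gens) i.

Lemma chi_conjugator i : chi (conjugator i) = 0%R.
Proof.
rewrite /conjugator; case: (ltnP i (size (1 :: gens))) => [/(mem_nth 1)|h].
  rewrite inE => /orP[/eqP->|]; first exact: chi1.
  case/mapP => s; rewrite mem_filter => /andP[/negPf st _] ->.
  by rewrite chi_gen /texp st.
by rewrite nth_default // chi1.
Qed.

(** The parity of [i] selects the generator and [i./2] the conjugator. Distinct conjugators get
    distinct levels, so that the functionals [psi] separate them; level 0 is left for the two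
    starting elements of the chain. *)
Definition marker i : surf :=
  celt i./2.+1 (ab1 (odd i)) ^ conjugator i./2.

Theorem surface_rigid : exists Z : surf, forall (f : gaut surf) u,
  f Z = Z ^ u -> exists v, forall x, f x = x ^ v.
Proof.
pose m := (size gens).+1.*2.
have lam_marker k b i : lam (psi k (ab1 b)) (rsg 0%R (marker i)) =
    (if (b == odd i) && (i./2.+1%:Z == k)%R then 1%R else 0%R).
  by rewrite lam_conj_celt //; exact: chi_conjugator.
have [||||||||||Z hZ] := @chain_exists surf I hom_kernel (rsg 0%R) hom_kernel1
  hom_kernelM hom_kernelV hom_kernel_aut rsg0M
  (fun x hx => rsg_eq1 (hom_kernel_chi hx))
  (celt 0 (ab1 false)) (psi 0%R (ab1 true)) (psi 0%R (ab1 false)) (celt_kernel _ _)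
  (psi_bounded _ _) (psi_bounded _ _) _ _ (celt 0 (ab1 true)) marker
  (fun i => psi i./2.+1%:Z%R (ab1 (odd i))) m (celt_kernel _ _).
- by rewrite lam_celt.
- by rewrite lam_celt.
- by move=> i; exact/hom_kernelJ/celt_kernel.
- by move=> i; exact: psi_bounded.
- by rewrite lam_celt.
- by move=> i; rewrite lam_marker; case: ifP => // /andP[_ /eqP]; lia.
- by move=> i; rewrite lam_celt; case: ifP => // /andP[_ /eqP]; lia.
- by move=> i; rewrite lam_celt; case: ifP => // /andP[_ /eqP]; lia.
- by move=> i; rewrite lam_marker !eqxx.
- move=> i j ji; rewrite lam_marker; case: ifP => // /andP[/eqP e1 /eqP e2].
  by move: (odd_double_half i) (odd_double_half j) ji; rewrite e1; lia.
exists Z => f u /hZ[v [f1 f2 f3]]; exists v => x.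
pose h : gaut surf := inn v^-1 * f; have [hM _] := gautP h.
have hV := morphV_of hM.
have hE y z : f y = z ^ v -> h y = z.
  by move=> e; rewrite /h [LHS](_ : _ = f y ^ v^-1) // e conjgK.
suff hid y : h y = y.
  by have := hid x; rewrite /h [LHS](_ : _ = f x ^ v^-1) // => {2}<-; rewrite conjgKV.
have h0 b : h (celt 0 (ab1 b)) = celt 0 (ab1 b) by case: b; exact: hE.
have hm i : (i < m)%N -> h (marker i) = marker i by move=> im; apply/hE/f3.
have hc i b : (i < (size gens).+1)%N ->
    h (celt i.+1 (ab1 b) ^ conjugator i) = celt i.+1 (ab1 b) ^ conjugator i.
  move=> im; have := hm (b + i.*2)%N.
  by rewrite /marker half_bit_double oddD odd_double addbF oddb; apply; rewrite /m; lia.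
have celtS' j b : celt j.+1 (ab1 b) = celt j (ab1 b) ^ T^-1.
  by rewrite celtS /conjg invgK [RHS]mulgA.
(* [celt 1] is the conjugate of [celt 0] by t^-1, and [h] fixes both, for either choice of [b]; so
   [h T] and [T] differ by an element commuting with both [celt 0]. *)
have hT : h T = T.
  suff : (h T)^-1 * T^-1^-1 = 1 by rewrite invgK => /(canRL (mulKVg _)); rewrite mulg1.
  apply: (@celt_commute 0) => b; apply: conj_eq_commute.
  have := hc 0%N b isT.
  by rewrite /conjugator /= conjg1 celtS' (morphJ_of hM) hV h0.
have hcelt j b : h (celt j (ab1 b)) = celt j (ab1 b).
  by elim: j => [|j IH]; rewrite ?h0 // !celtS' (morphJ_of hM) hV hT IH.
(* The same argument at level [i.+1]: [h] fixes the elements [celt] there and their conjugates by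
   [gen s]. *)
have hgen s : h (gen s) = gen s.
  have [->//|st] := eqVneq s tgen.
  have sg : gen s \in 1 :: gens.
    by rewrite inE; apply/orP; right; apply/map_f; rewrite mem_filter st mem_enum.
  set i := index (gen s) (1 :: gens).
  have yE : conjugator i = gen s by exact: nth_index.
  suff : h (gen s) * (gen s)^-1 = 1 by move/(canRL (mulgVK _)); rewrite mul1g.
  apply: (@celt_commute i.+1) => b; apply: conj_eq_commute.
  have := hc i b; rewrite -index_mem in sg => /(_ sg).
  by rewrite yE (morphJ_of hM) hcelt.
have idM : {morph (fun z : surf => z) : a b / a * b} by [].
rewrite -[y]pw_repr (morph_eval _ hM) [RHS](morph_eval _ idM).
congr (eval _ _); apply/funext => s; exact: hgen.
Qed.

End Rigid.

(** * Outer automorphisms acting on classes of homomorphisms *)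

Section OuterAction.
Variables (g : nat) (F : finGroupType).
Local Notation surf := (surface_group g).
Local Notation tup := {ffun ('I_g + 'I_g)%type -> F}.
Local Notation surf_gen s := (pw [:: surface_relator g] [:: (s, false)]).
Implicit Types (p q : tup) (f h : gaut surf) (c d : gout surf).

(** Homomorphisms to [F] are encoded by the images of the generators, so that they form a finite
    set. *)
Definition is_hom_tup p : bool :=
  eval (p : sgen g -> F) (surface_relator g) == 1.

Definition tup_hom p (x : surf) : F := eval (p : sgen g -> F) (repr x).

Lemma tup_hom_pw p w : is_hom_tup p ->
  tup_hom p (pw _ w) = eval (p : sgen g -> F) w.
Proof.
move=> /eqP hp; apply: eval_equiv (repr_pi _ w) => r.
by rewrite inE => /eqP->.
Qed.

Lemma tup_homM p : is_hom_tup p -> {morph tup_hom p : x y / x * y}.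
Proof.
by move=> hp x y; rewrite -[x]pw_repr -[y]pw_repr -pw_cat !tup_hom_pw // eval_cat.
Qed.

Definition tup_of (th : surf -> F) : tup := [ffun s => th (surf_gen s)].

Lemma tup_ofK (th : surf -> F) : {morph th : x y / x * y} ->
  is_hom_tup (tup_of th) /\ tup_hom (tup_of th) =1 th.
Proof.
move=> thM.
have E w : eval (tup_of th : sgen g -> F) w = th (pw _ w).
  rewrite (morph_eval w thM); congr (eval _ _); apply/funext => s.
  by rewrite /tup_of ffunE.
have hp : is_hom_tup (tup_of th).
  rewrite /is_hom_tup E; apply/eqP; rewrite -(morph1_of thM); congr th.
  exact: pw_relator (mem_head _ _).
by split=> // x; rewrite -[x]pw_repr tup_hom_pw // E.
Qed.

Lemma tup_homK p : is_hom_tup p -> tup_of (tup_hom p) = p.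
Proof.
move=> hp; apply/ffunP => s; rewrite ffunE tup_hom_pw //=.
by rewrite mulg1.
Qed.

Definition tup_conj p (z : F) : tup := [ffun s => p s ^ z].
Definition tup_act f p : tup := tup_of (tup_hom p \o f).

Lemma tup_actK f p : is_hom_tup p ->
  is_hom_tup (tup_act f p) /\ tup_hom (tup_act f p) =1 tup_hom p \o f.
Proof.
move=> hp; apply: tup_ofK => x y /=.
by rewrite (gautP f).1 tup_homM.
Qed.

Lemma tup_conjK p z : is_hom_tup p ->
  is_hom_tup (tup_conj p z) /\ tup_hom (tup_conj p z) =1 fun x => tup_hom p x ^ z.
Proof.
move=> hp; have -> : tup_conj p z = tup_of (fun x => tup_hom p x ^ z).
  by apply/ffunP => s; rewrite !ffunE tup_hom_pw //= mulg1.
by apply: tup_ofK => x y; rewrite tup_homM // conjMg.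
Qed.

Definition tup_class p : {set tup} := [set tup_conj p z | z : F].

Lemma tup_classJ p z : tup_class (tup_conj p z) = tup_class p.
Proof.
apply/setP => q; apply/imsetP/imsetP => -[t _ ->].
  by exists (z * t) => //; apply/ffunP => s; rewrite !ffunE conjgM.
by exists (z^-1 * t) => //; apply/ffunP => s; rewrite !ffunE -conjgM mulKVg.
Qed.

Lemma tup_class_eq p q : tup_class p = tup_class q -> exists z, p = tup_conj q z.
Proof.
move=> e; have : p \in tup_class p.
  by apply/imsetP; exists 1 => //; apply/ffunP => s; rewrite ffunE conjg1.
by rewrite e => /imsetP[z _ ->]; exists z.
Qed.

(** Changing [f] by an inner automorphism, or the tuple by a conjugation, only conjugates the
    result; outer automorphisms therefore act on classes. *)
Lemma tup_class_act f h p q : is_hom_tup q -> inner_equiv f h ->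
  tup_class p = tup_class q -> tup_class (tup_act f p) = tup_class (tup_act h q).
Proof.
move=> hq [u fh] /tup_class_eq[z ->].
suff -> : tup_act f (tup_conj q z) = tup_conj (tup_act h q) ((tup_hom q u)^-1 * z).
  exact: tup_classJ.
apply/ffunP => s; rewrite !ffunE /= (tup_conjK z hq).2 fh.
by rewrite (morphJ_of (tup_homM hq)) conjgM conjgK.
Qed.

Lemma tup_actM f h p : is_hom_tup p -> tup_act (f * h) p = tup_act h (tup_act f p).
Proof. by move=> hp; apply/ffunP => s; rewrite !ffunE /= (tup_actK f hp).2. Qed.

(* Precomposition with [c] on the conjugacy classes of homomorphisms to [F]; all
   other sets of tuples are fixed. *)
Definition class_act c (D : {set tup}) : {set tup} :=
  if [pick p | is_hom_tup p && (D == tup_class p)] is Some p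
  then tup_class (tup_act (repr c) p) else D.

Lemma class_actE c f p : is_hom_tup p -> \pi_(gout surf) f = c ->
  class_act c (tup_class p) = tup_class (tup_act f p).
Proof.
move=> hp fc; rewrite /class_act; case: pickP => [q /andP[hq /eqP e]|/(_ p)].
  apply: tup_class_act => //; apply/gout_piE; rewrite reprK -fc //.
by rewrite hp eqxx.
Qed.

Lemma class_act_id c D : (forall p, is_hom_tup p -> D != tup_class p) ->
  class_act c D = D.
Proof.
move=> hD; rewrite /class_act; case: pickP => [p /andP[hp]|//].
by rewrite (negPf (hD p hp)).
Qed.

Lemma class_actM c d D : class_act (c * d) D = class_act d (class_act c D).
Proof.
have [[p hp ->]|nD] := pselect (exists2 p, is_hom_tup p & D = tup_class p).
  rewrite (class_actE hp (reprK c)) (class_actE (tup_actK _ hp).1 (reprK d)) -tup_actM //.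
  by apply: class_actE.
have hD p : is_hom_tup p -> D != tup_class p.
  by move=> hp; apply/eqP => e; apply: nD; exists p.
by rewrite !class_act_id.
Qed.

Lemma class_act1 D : class_act 1 D = D.
Proof.
have [[p hp ->]|nD] := pselect (exists2 p, is_hom_tup p & D = tup_class p).
  rewrite (@class_actE _ 1 _ hp) //; congr tup_class.
  exact: tup_homK.
by rewrite class_act_id // => p hp; apply/eqP => e; apply: nD; exists p.
Qed.

Lemma class_act_inj c : injective (class_act c).
Proof.
by apply: (can_inj (g := class_act c^-1)) => D; rewrite -class_actM mulgV class_act1.
Qed.

Definition class_perm c : {perm {set tup}} := perm (@class_act_inj c).

(** Precomposition is a right action, in agreement with the product of permutations, which composes
    from left to right. *)
Lemma class_permM : {morph class_perm : c d / c * d}.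
Proof. by move=> c d; apply/permP => D; rewrite permM !permE class_actM. Qed.

Lemma class_perm_eq (th : surf -> F) c d x : {morph th : x y / x * y} ->
  class_perm c = class_perm d -> exists z, th (repr c x) = th (repr d x) ^ z.
Proof.
move=> thM /permP/(_ (tup_class (tup_of th))); rewrite !permE.
have [hp hE] := tup_ofK thM.
rewrite (class_actE hp (reprK c)) (class_actE hp (reprK d)) => /tup_class_eq[z e].
exists z; have := congr1 (fun p => tup_hom p x) e.
rewrite (tup_conjK z (tup_actK _ hp).1).2 !(tup_actK _ hp).2 /=.
by rewrite !hE.
Qed.

End OuterAction.

(** * From finite quotients of the surface group to separability of outer automorphisms *)

Lemma separable_from_quotient g (G H : set (gout (surface_group g))) :
  (forall c, G c -> ~ H c -> exists (F : finGroupType) (th : surface_group g -> F) x,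
    {morph th : x y / x * y} /\
    forall d, H d -> ~ exists z, th (repr c x) = th (repr d x) ^ z) ->
  separable G H.
Proof.
move=> h c Gc Hc; have [F [th [x [thM nz]]]] := h c Gc Hc.
exists {perm {set {ffun ('I_g + 'I_g)%type -> F}}}, (@class_perm g F); split.
  by move=> a b _ _; exact: class_permM.
by case=> d Hd /esym/(class_perm_eq x thM); exact: nz.
Qed.

Section InnerAutomorphisms.
Variable G : groupType.
Implicit Types (y z : G) (f h : gaut G).

Lemma gautM f h y : (f * h : gaut G) y = f (h y). Proof. by []. Qed.

Lemma innE y x : inn y x = x ^ y. Proof. by []. Qed.

Lemma innM y z : inn (y * z) = inn z * inn y.
Proof. by apply: gaut_eqP => x; rewrite gautM !innE conjgM. Qed.

Lemma inn1 : inn 1 = 1 :> gaut G.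
Proof. by apply: gaut_eqP => x; rewrite innE conjg1. Qed.

Lemma innV y : inn y^-1 = (inn y)^-1.
Proof. by apply: (mulgI (inn y)); rewrite -innM mulVg inn1 mulgV. Qed.

Lemma inn_aut f y : inn (f y) = inn y ^ f^-1.
Proof.
rewrite /conjg invgK mulgA; apply: (mulIg f); rewrite mulgVK.
by apply: gaut_eqP => x; rewrite !gautM !innE (morphJ_of (gautP f).1).
Qed.

Lemma pi_gout_mul f h : \pi_(gout G) (f * h) = \pi_(gout G) f * \pi_(gout G) h.
Proof. by rewrite -(pi_goutM f h). Qed.

Lemma pi_gout_inner f v : (forall x, f x = x ^ v) -> \pi_(gout G) f = 1.
Proof. by move=> fv; symmetry; apply/gout_piE; exists v. Qed.

End InnerAutomorphisms.

(** The surface group is centerless. *)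
Lemma surf_inn_inj n (y z : surface_group n.+2) : inn y = inn z -> y = z.
Proof.
move=> e; suff : y * z^-1 = 1 by move/(canRL (mulgVK _)); rewrite mul1g.
apply: surf_centerless => x.
have : inn (y * z^-1) x = x by rewrite innM e innV mulVg.
by rewrite innE => xE; rewrite /commute [RHS]conjgC xE.
Qed.

Lemma separable_genus_ge2 n (G H : set (gout (surface_group n.+2))) :
  is_subgroup H -> conjugacy_separable (extension_group H) -> separable G H.
Proof.
move=> [H1 Hdiv] cs; apply: separable_from_quotient => c _ Hc.
have HV d : H d -> H d^-1 by move=> Hd; have := Hdiv _ _ H1 Hd; rewrite mul1g.
have [Z hZ] := surface_rigid n.
pose E : set (gaut (surface_group n.+2)) := fun f => H (\pi_(gout _) f).
have {}cs : conjugacy_separable E by [].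
have EV f : E f -> E f^-1.
  move=> /HV Ef; rewrite /E /= (_ : \pi_(gout _) f^-1 = (\pi_(gout _) f)^-1) //.
  by apply: (mulgI (\pi_(gout _) f)); rewrite -pi_gout_mul !mulgV.
have Einn y : E (inn y) by rewrite /E /= (@pi_gout_inner _ _ y).
have nc : ~ conjugate_in E (inn Z) (inn (repr c Z)).
  move=> [z Ez e]; apply: Hc.
  have zZ : (z : gaut _) (repr c Z) = Z.
    by apply: surf_inn_inj; rewrite inn_aut e -conjgM mulgV conjg1.
  have [|v hv] := hZ (z * repr c) 1; first by rewrite gautM zZ conjg1.
  have := pi_gout_inner hv; rewrite pi_gout_mul reprK => /(canRL (mulKg _)) ->.
  by rewrite mulg1; exact: HV.
have [F [Th [ThM _ nTh]]] := cs _ _ (Einn Z) (Einn (repr c Z)) nc.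
(* [inn] reverses products, and the inverse restores their order. *)
exists F, (fun y => Th (inn y^-1)), Z; split.
  by move=> y z; rewrite invMg innM ThM.
(* For [d] in [H] the automorphism [repr d] lies in [E] and conjugates [inn Z] to [inn (repr d Z)];
   their images in [F] are thus conjugate, and [e] carries this over to [inn (repr c Z)]. *)
move=> d Hd [w e]; apply: nTh.
have Ed : E (repr d) by rewrite /E /= reprK.
have E1 : E 1 by exact: H1.
have Th1 : Th 1 = 1 by apply: (mulgI (Th 1)); rewrite -ThM // !mulg1.
have ThV f : E f -> Th f^-1 = (Th f)^-1.
  by move=> Ef; apply: (mulgI (Th f)); rewrite -ThM ?mulgV //; exact: EV.
have EM f h : E f -> E h -> E (f * h).
  by move=> Ef Eh; rewrite /E /= pi_gout_mul -[X in _ * X]invgK; apply: Hdiv => //; exact: HV.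
move: e; rewrite !innV !ThV // conjVg => /invg_inj ->.
exists ((Th (repr d))^-1 * w); rewrite conjgM; congr (_ ^ w).
have EdV := EV _ Ed; have EZ := EM _ _ (Einn Z) EdV.
by rewrite inn_aut {1}/conjg ThM ?ThM ?ThV //; exact: EV.
Qed.

Lemma intr_Zp_eq0 n (k : int) :
  (k%:~R == 0 :> 'Z_n.+2)%R -> absz k < n.+2 -> absz k = 0%N.
Proof.
move=> k0 lt; have {}k0 : ((absz k)%:R == 0 :> 'Z_n.+2)%R.
  by case: (intP k) k0 => // m; rewrite ?mulrNz ?GRing.oppr_eq0.
by move: k0; rewrite Zp_nat -val_eqE /= modn_small // => /eqP.
Qed.

(** * The torus *)

Section Torus.
Local Notation surf := (surface_group 1).
Import GRing.Theory Num.Theory Order.TTheory.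
Local Notation a := (pw [:: surface_relator 1] [:: (inl ord0 : sgen 1, false)]).
Local Notation b := (pw [:: surface_relator 1] [:: (inr ord0 : sgen 1, false)]).
Implicit Types (y z : surf) (s : sgen 1).

Lemma torus_relator : surface_relator 1 =
  [:: (inl ord0, false); (inr ord0, false); (inl ord0, true); (inr ord0, true)].
Proof.
rewrite /surface_relator enum_ordSl.
by have -> : enum 'I_0 = [::] by apply: size0nil; rewrite size_enum_ord.
Qed.

Lemma torus_ab : commute a b.
Proof.
have : pw [:: surface_relator 1] [:: (inl ord0, false); (inr ord0, false);
    (inl ord0, true); (inr ord0, true)] = 1.
  by rewrite -torus_relator; exact: pw_relator (mem_head _ _).
rewrite !(pw_cons _ _ (_ :: _)).
have -> : pw [:: surface_relator 1] [:: (inl ord0 : sgen 1, true)] = a^-1 by rewrite -pw_inv.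
have -> : pw [:: surface_relator 1] [:: (inr ord0 : sgen 1, true)] = b^-1 by rewrite -pw_inv.
by rewrite !mulgA => /(canRL (mulgK _)); rewrite mul1g invgK => /(canRL (mulgVK _)).
Qed.

Definition delta s (s' : sgen 1) : int := if s' == s then 1%R else 0%R.

Lemma exponent_sumE s w : exponent_sum s w = wsum (delta s) w.
Proof.
elim: w => [|[s' c] w IH]; first by rewrite /wsum big_nil.
rewrite /wsum big_cons -/(wsum _ w) -IH /exponent_sum /= !xpair_eqE /delta.
by case: eqP => _; case: c => /=; lia.
Qed.

Lemma exponent_sum_equiv s u v : word_equiv [:: surface_relator 1] u v ->
  exponent_sum s u = exponent_sum s v.
Proof.
rewrite !exponent_sumE; apply: wsum_equiv => r; rewrite inE => /eqP->.
by rewrite torus_relator /wsum !big_cons big_nil /=; lia.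
Qed.

Definition coord s y : int := exponent_sum s (repr y).

Lemma coord_pw s w : coord s (pw _ w) = exponent_sum s w.
Proof. exact: exponent_sum_equiv (repr_pi _ _). Qed.

Lemma coordM s y z : coord s (y * z) = (coord s y + coord s z)%R.
Proof.
by rewrite -[y]pw_repr -[z]pw_repr -pw_cat !coord_pw !exponent_sumE wsum_cat.
Qed.

Lemma coord1 s : coord s 1 = 0%R.
Proof. by apply: (addrI (coord s 1)); rewrite -coordM mulg1 addr0. Qed.

Lemma coordV s y : coord s y^-1 = (- coord s y)%R.
Proof. by apply: (addrI (coord s y)); rewrite -coordM mulgV coord1 subrr. Qed.

Lemma torus_abelian y z : commute y z.
Proof.
have cg (x : surf) : commute a x -> commute b x -> forall w, commute (pw _ w) x.
  move=> ax bx; elim=> [|[s c] w IH]; first by rewrite pw_nil; exact/commute_sym/commute1.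
  rewrite pw_cons; apply/commute_sym/commuteM; apply/commute_sym => //.
  have gx : commute (pw [:: surface_relator 1] [:: (s, false)]) x.
    by case: s => i; rewrite (ord1 i).
  case: c => //.
  have -> : pw [:: surface_relator 1] [:: (s, true)] = (pw _ [:: (s, false)])^-1.
    by rewrite -pw_inv.
  exact/commute_sym/commuteV/commute_sym.
rewrite -[y]pw_repr -[z]pw_repr; apply: (cg); apply/commute_sym/(cg) => //.
- exact: commute_sym torus_ab.
- exact: torus_ab.
Qed.

Lemma torus_normal_form w :
  pw _ w = zexp a (exponent_sum (inl ord0) w) * zexp b (exponent_sum (inr ord0) w).
Proof.
rewrite !exponent_sumE; elim: w => [|[s c] w IH].
  by rewrite pw_nil /wsum !big_nil mulg1.
rewrite pw_cons torus_abelian IH /wsum !big_cons -!/(wsum _ w) /delta /=.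
have -> : pw [:: surface_relator 1] [:: (s, c)] =
    if c then (pw _ [:: (s, false)])^-1 else pw _ [:: (s, false)].
  by case: c => //; rewrite -pw_inv.
case: s => i; rewrite (ord1 i) !eqxx; case: c => /=.
- by rewrite oppr0 add0r addrC zexpB -mulgA [zexp b _ * _]torus_abelian mulgA.
- by rewrite add0r addrC zexpS -mulgA [zexp b _ * _]torus_abelian mulgA.
- by rewrite oppr0 add0r addrC zexpB mulgA.
- by rewrite add0r addrC zexpS mulgA.
Qed.

Lemma coord_inj y z : (forall s, coord s y = coord s z) -> y = z.
Proof.
move=> e; rewrite -[y]pw_repr -[z]pw_repr (torus_normal_form (repr y)).
by rewrite (torus_normal_form (repr z)) -!/(coord _ _) !e.
Qed.

Lemma torus_conj y z : y ^ z = y.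
Proof. by rewrite /conjg torus_abelian -mulgA mulgV mulg1. Qed.

Lemma inv_automorphism : is_automorphism (fun y : surf => y^-1).
Proof.
apply/asboolP; split; last by exists (fun y => y^-1) => y; exact: invgK.
by move=> y z; rewrite invMg torus_abelian.
Qed.

Definition hyperelliptic : gaut surf :=
  exist (fun f : surf -> surf => is_automorphism f) _ inv_automorphism.

Lemma repr_torus (f : gaut surf) y : repr (\pi_(gout surf) f) y = f y.
Proof. by have [z ->] := gout_repr_pi f; rewrite torus_conj. Qed.

(** Both arguments of the bilinear form change sign. *)
Lemma hyperelliptic_mcg : mapping_class_group 1 (\pi_(gout surf) hyperelliptic).
Proof.
move=> y z; rewrite !repr_torus /intersection_form.
apply: eq_bigr => i _; rewrite -!/(coord _ _) /hyperelliptic /=.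
by rewrite !coordV !mulrNN.
Qed.

Lemma separable_genus1 (H : set (gout surf)) :
  is_subgroup H -> torsion_free H -> malnormal (mapping_class_group 1) H ->
  separable (mapping_class_group 1) H.
Proof.
move=> [H1 Hdiv] tf mal.
pose c := \pi_(gout surf) hyperelliptic.
have Hc : ~ H c.
  move=> Hc; have c1 : c = 1.
    apply: (tf c 2%N Hc) => //; rewrite /c expgS expg1 -pi_gout_mul.
    by rewrite (@pi_gout_inner _ _ 1) // => y; rewrite conjg1; exact: invgK.
  have : a^-1 = a by rewrite -[LHS](repr_torus hyperelliptic) -/c c1 repr_torus.
  move/(congr1 (coord (inl ord0))); rewrite coordV coord_pw exponent_sumE.
  by rewrite /wsum big_seq1 /delta /=.
have cc d : c * d * c^-1 = d.
  apply: (mulIg c); rewrite mulgVK -[d]reprK -!pi_gout_mul; congr (\pi_(gout _) _).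
  apply: gaut_eqP => y; rewrite !gautM.
  by rewrite /= (morphV_of (gautP _).1).
(* As [c] centralizes [H], the intersection in the definition of malnormality is all of [H]. *)
have H1' d : H d -> d = 1.
  move=> Hd; have := mal c hyperelliptic_mcg Hc.
  by move/(congr1 (fun A : set _ => A d)); rewrite /= => <-; split=> //; exists d.
apply: separable_from_quotient => d _ Hd.
have [y yE] : exists y, repr d y <> y.
  apply: contrapT => /forallNP h; apply: Hd; rewrite -[d]reprK.
  rewrite (@pi_gout_inner _ _ 1) // => y; rewrite conjg1.
  exact: contrapT (h y).
have [s sE] : exists s, coord s (repr d y) <> coord s y.
  apply: contrapT => /forallNP h; apply: yE; apply: coord_inj => s.
  exact: contrapT (h s).
(* The modulus [N.+2] exceeds the nonzero difference of coordinates, which therefore survives, and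
   is at least 2, as the ring structure on ['Z_N.+2] asks. *)
pose N := absz (coord s (repr d y) - coord s y)%R.
pose th y : 'Z_N.+2 := (coord s y)%:~R%R.
exists 'Z_N.+2, th, y; split; first by move=> u v; rewrite /th coordM rmorphD.
move=> e /H1' ->; rewrite repr_torus; case=> z.
rewrite /conjg [_ * z]Zp_mulgC mulKg /th => /eqP.
rewrite -subr_eq0 -rmorphB => /intr_Zp_eq0; rewrite -/N ltnW // => /(_ isT).
by move=> /eqP; rewrite absz_eq0 subr_eq0 => /eqP.
Qed.

End Torus.

(** * Separability in every positive genus *)

Theorem theorem1p1 (R : realType) (g : nat) (H : set (gout (surface_group g))) :
  (1 <= g)%N ->
  is_subgroup H ->
  (H `<=` mapping_class_group g)%classic ->
  torsion_free H ->
  malnormal (mapping_class_group g) H ->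
  convex_cocompact R H ->
  conjugacy_separable (extension_group H) ->
  separable (mapping_class_group g) H.
Proof.
case: g H => [//|[|n]] H _ sH _ tH mH _ cH; first exact: separable_genus1.
exact: separable_genus_ge2.
Qed.
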